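(* Let $Z(t),t\in\mathcal T$ be a random process with values in $[-\infty,\infty)$ such that $\mathbb E\{e^{Z(t)}\}=1$, $t\in\mathcal T$, and let $\zeta_Z$ be its associated max-stable process. Then the following are equivalent: a) $Z$ is Brown-Resnick stationary. b) For any functional $\Gamma:\mathcal F_{-\infty}\to[0,\infty)$ which is $\mathcal B(\mathcal F_{-\infty})/\mathcal B(\mathbb R)$ measurable and satisfies $\Gamma(f+c)=\Gamma(f)$ for all $c\in\mathbb R$ and all $f$, $$\mathbb E\{e^{Z(a+h)}\Gamma(Z)\}=\mathbb E\{e^{Z(a)}\Gamma(L^hZ)\}=\mathbb E\{\Gamma(L^h\Theta_a)\},\qquad a,a+h\in\mathcal T,$$ provided that the expectations exist. c) For any $a,h\in\mathcal T$, $$\Theta_{a+h}\overset{fdd}{=}L^h\Theta_a .$$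
   Context: $\mathcal T=\mathbb R^d$ or $\mathbb Z^d$, $d\ge1$; $e^{-\infty}=0$; $\overset{fdd}{=}$ means equality of all finite dimensional distributions; $L^hf(t)=f(t-h)$. The associated max-stable process is $\zeta_Z(t)=\max_{i\ge1}(P_i+Z_i(t))$, $t\in\mathcal T$, where $\sum_i\varepsilon_{P_i}$ is a Poisson point process on $\mathbb R$ with intensity $e^{-x}dx$ and $Z_i$ are independent copies of $Z$, independent of the point process. $Z$ is Brown-Resnick stationary if $\zeta_Z$ is stationary, i.e. $\zeta_Z\overset{fdd}{=}L^h\zeta_Z$ for any $h\in\mathcal T$. $\mathcal F_{-\infty}$ is the set of functions $\mathcal T\to[-\infty,\infty)$ excluding the function identically $-\infty$, with $\sigma$-field $\mathcal B(\mathcal F_{-\infty})$ generated by the evaluation maps. For $h\in\mathcal T$ (note $\mathbb P\{Z(h)>-\infty\}>0$), let $V_h$ have the conditional law of $Z$ given $Z(h)>-\infty$, let $V_h^{[h]}$ have law $\mathbb P\{V_h^{[h]}\in A\}=\mathbb E\{e^{V_h(h)-\ln\mathbb E\{e^{V_h(h)}\}}\mathbb I\{V_h\in A\}\}$, $A\in\mathcal B(\mathcal F_{-\infty})$, and set $\Theta_h(t)=V_h^{[h]}(t)-V_h^{[h]}(h)$, $t\in\mathcal T$. *)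

(* Defs.v *)
From HB Require Import structures.
From mathcomp Require Import all_boot all_order all_algebra.
From mathcomp Require Import all_classical all_reals all_analysis.
From mathcomp Require Import measurable_realfun.

Set Implicit Arguments.
Unset Strict Implicit.
Unset Printing Implicit Defensive.

Import Order.TTheory GRing.Theory Num.Theory.

Local Open Scope classical_set_scope.
Local Open Scope ring_scope.
Local Open Scope ereal_scope.

Variant time_domain := Euclidean | Lattice.

Definition time_space (R : realType) (k : time_domain) (d : nat) : zmodType :=
  match k with
  | Euclidean => 'rV[R]_d
  | Lattice => 'rV[int]_d
  end.

(* L^h, for functions and, with [A] a type of random variables, for processes *)
Definition lag (T : zmodType) (A : Type) (h : T) (f : T -> A) : T -> A :=
  fun t => f (t - h)%R.

Record Fminf (R : realType) (T : zmodType) := MkFminf {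
  Ffun :> T -> \bar R ;
  Ffun_neqy : forall t, Ffun t != +oo ;
  Ffun_nontrivial : exists t, Ffun t != -oo }.

Section Fminf_instances.
Variables (R : realType) (T : zmodType).
Implicit Type f : Fminf R T.

Let F0 : Fminf R T.
Proof. by exists (fun=> 0) => //; exists 0%R. Defined.

HB.instance Definition _ := gen_eqMixin (Fminf R T).
HB.instance Definition _ := gen_choiceMixin (Fminf R T).
HB.instance Definition _ := isPointed.Build (Fminf R T) F0.

Definition Feval_sets : set_system (Fminf R T) :=
  \bigcup_t preimage_set_system setT (fun f => f t)
    (measurable : set (set (\bar R))).

HB.instance Definition _ :=
  Measurable.copy (Fminf R T) (g_sigma_algebraType Feval_sets).

Lemma Fadd_neqy f (c : R) t : f t + c%:E != +oo.
Proof. by have := Ffun_neqy f t; case: (f t). Qed.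

Lemma Fadd_nontrivial f (c : R) : exists t, f t + c%:E != -oo.
Proof. by have [t ft] := Ffun_nontrivial f; exists t; move: ft; case: (f t). Qed.

Definition Fadd f (c : R) : Fminf R T :=
  MkFminf (Fadd_neqy f c) (Fadd_nontrivial f c).

(* A path of a process need not lie in Fminf (it may be identically -oo), so a
   functional on Fminf is extended by 0 to all functions. In the expectations
   below, the value of the extension at -oo is multiplied by e^{-oo} = 0. *)
Definition Fext (Gam : Fminf R T -> R) (f : T -> \bar R) : R :=
  if pselect (exists g : Fminf R T, Ffun g = f) is left fF
  then Gam (projT1 (cid fF)) else 0%R.

End Fminf_instances.

Definition process d (O : measurableType d) (R : realType) (T : Type)
    (X : T -> O -> \bar R) : Prop :=
  forall t, measurable_fun setT (X t) /\ forall w, X t w != +oo.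

Definition fdd_eq (R : realType) (T : Type)
    d1 (O1 : measurableType d1) (P1 : probability O1 R) (X1 : T -> O1 -> \bar R)
    d2 (O2 : measurableType d2) (P2 : probability O2 R) (X2 : T -> O2 -> \bar R)
    : Prop :=
  forall n (t : n.-tuple T) (B : set (n.-tuple (\bar R))), measurable B ->
    P1 [set w | B [tuple X1 (tnth t i) w | i < n]] =
    P2 [set w | B [tuple X2 (tnth t i) w | i < n]].

Definition stationary (R : realType) (T : zmodType) d (O : measurableType d)
    (P : probability O R) (X : T -> O -> \bar R) : Prop :=
  forall h, fdd_eq P X P (lag h X).

Definition mutually_independent (R : realType) d (O : measurableType d)
    (P : probability O R) (I : eqType) (S : I -> set_system O) : Prop :=
  forall (s : seq I) (E : I -> set O), uniq s ->
    (forall i, i \in s -> S i (E i)) ->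
    P (\bigcap_(i in [set` s]) E i) = (\prod_(i <- s) fine (P (E i)))%:E.

Definition independent (R : realType) d (O : measurableType d)
    (P : probability O R) (S1 S2 : set_system O) : Prop :=
  forall A B, S1 A -> S2 B -> P (A `&` B) = P A * P B.

Definition sigma_generated d (O : measurableType d) d' (E : measurableType d')
    (I : Type) (X : I -> O -> E) : set_system O :=
  <<s \bigcup_i preimage_set_system setT (X i) (measurable : set (set E)) >>.

Definition counting_process (R : realType) (O : Type) (Q : nat -> O -> R)
    (A : set R) (w : O) : \bar R :=
  \sum_(0 <= i <oo) \d_(Q i w) A.

Definition intensity (R : realType) (A : set R) : \bar R :=
  \int[lebesgue_measure]_(x in A) (expR (- x))%:E.

(* The library's [poisson_pmf] is not used: at rate 0 it is 1 at every k. *)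
Definition poisson_point_process (R : realType) d (O : measurableType d)
    (P : probability O R) (Q : nat -> O -> R) : Prop :=
  [/\ forall i, measurable_fun setT (Q i),
      forall A : set R, measurable A -> intensity A = +oo ->
        P [set w | counting_process Q A w = +oo] = 1,
      forall (A : set R) (lam : R) (k : nat), measurable A ->
        intensity A = lam%:E ->
        P [set w | counting_process Q A w = k%:R%:E] =
        (expR (- lam) * lam ^+ k / k`!%:R)%:E
    & forall n (A : 'I_n -> set R), (forall i, measurable (A i)) ->
        trivIset setT A ->
        mutually_independent P
          (fun i => g_sigma_algebra_preimage (counting_process Q (A i)))].

(* [Q i] are the points and [Zi i] the copies of [Z]. The copies are independent
   of the enumerated points, not only of the point set, since [zeta] depends on
   how the points are matched with the copies. *)
Record max_stable_construction (R : realType) (T : zmodType)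
    d (O : measurableType d) (P : probability O R) (Z : T -> O -> \bar R)
    d' (O' : measurableType d') (P' : probability O' R)
    (Q : nat -> O' -> R) (Zi : nat -> T -> O' -> \bar R) : Prop := {
  msc_poisson : poisson_point_process P' Q ;
  msc_process : forall i, process (Zi i) ;
  msc_copies : forall i, fdd_eq P' (Zi i) P Z ;
  msc_iid : mutually_independent P' (fun i => sigma_generated (Zi i)) ;
  msc_indep : independent P' (sigma_generated Q)
                (sigma_generated (fun it : nat * T => Zi it.1 it.2)) }.

(* Almost surely the supremum is a maximum for every fixed [t] when
   E[e^{Z(t)}] = 1. *)
Definition zeta (R : realType) (T : Type) (O : Type)
    (Q : nat -> O -> R) (Zi : nat -> T -> O -> \bar R) (t : T) (w : O) : \bar R :=
  ereal_sup (range (fun i => (Q i w)%:E + Zi i t w)).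

Record conditional_law (R : realType) (T : zmodType)
    d (O : measurableType d) (P : probability O R) (Z : T -> O -> \bar R) (h : T)
    d' (O' : measurableType d') (P' : probability O' R)
    (V : O' -> Fminf R T) : Prop := {
  cond_measurable : measurable_fun setT V ;
  cond_lawE : forall A : set (Fminf R T), measurable A ->
    P' (V @^-1` A) =
    P [set w | Z h w != -oo /\ (@Ffun R T @` A) (Z ^~ w)]
      / P [set w | Z h w != -oo] }.

Record tilted_law (R : realType) (T : zmodType) (h : T)
    d (O : measurableType d) (P : probability O R) (V : O -> Fminf R T)
    d' (O' : measurableType d') (P' : probability O' R)
    (W : O' -> Fminf R T) : Prop := {
  tilt_measurable : measurable_fun setT W ;
  tilt_lawE : forall A : set (Fminf R T), measurable A ->
    P' (W @^-1` A) =
    \int[P]_w (expeR (V w h - lne (\int[P]_w' expeR (V w' h)))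
               * (\1_(V @^-1` A) w)%:E) }.

Definition Theta (R : realType) (T : zmodType) (O : Type)
    (W : O -> Fminf R T) (h t : T) (w : O) : \bar R := W w t - W w h.

Definition expectation_exists (R : realType) d (O : measurableType d)
    (P : probability O R) (X : O -> \bar R) : Prop :=
  \int[P]_w X^\+ w < +oo \/ \int[P]_w X^\- w < +oo.

(* Main.v *)
Require Import Defs.
From HB Require Import structures.
From mathcomp Require Import all_boot all_order all_algebra.
From mathcomp Require Import all_classical all_reals all_analysis.
From mathcomp Require Import measurable_realfun.
From mathcomp Require Import lra ring zify.

Set Implicit Arguments.
Unset Strict Implicit.
Unset Printing Implicit Defensive.

Import Order.TTheory GRing.Theory Num.Theory.
Import numFieldNormedType.Exports.

Local Open Scope classical_set_scope.
Local Open Scope ring_scope.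
Local Open Scope ereal_scope.

(** For a finite list [l] of pairs (t, x), let H_l(f) be the maximum of the
    numbers e^{f(t) - x}, (t, x) in [l]; this is [hmax l f]. The numbers
    E H_l(Z) govern both the max-stable process and the processes Theta, and
    the theorem holds because either family of laws can be recovered from them.

    On the max-stable side, zeta(t) <= x holds for all (t, x) in [l] if and
    only if H_l(Z_i) <= e^{-P_i} for every i. The points e^{-P_i} form a Poisson
    process of unit rate on the positive half-line and the H_l(Z_i) are
    independent marks, so the points that violate the inequality form a thinned
    process with E H_l(Z) points on average, and the probability that there is
    none is exp(- E H_l(Z)) ([poisson_max], [prob_below_zeta]). The events on
    the left are stable under intersection and generate, hence stationarity
    amounts to E H_l(Z) = E H_l(L^h Z) for all [l] and h ([stationary_zetaP]).

    On the side of Theta, unfolding the conditioning and the tilting gives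
    E g(Theta_a) = E e^{Z(a)} g(Z - Z(a)) for nonnegative measurable g
    ([theta_expectation]). Therefore the last two members of b) always agree,
    and b) as well as c) say that E e^{Y(s)} g(Y - Y(s)), called [spectral], is
    the same for Y = Z and Y = L^h Z: b) says so for all g at once, c) for the
    cylinder functions g, which is enough by a pi-lambda argument. The common
    content of b) and c) is recorded as [shift_invariant_shapes].

    The two sides are linked as follows. The right derivative at c = 1 of
    c |-> E max(c e^{Y(s)}, H_l(Y)), which is one of the maxima above, is
    E e^{Y(s)} 1(H_l(Y) <= e^{Y(s)}); this is [spectral] at the indicator of
    the orthant f(t) <= x, (t, x) in [l] ([eq_top_mass]). Conversely, cutting
    H_l(Y) according to the index at which the maximum is attained writes
    E H_l(Y) as a sum of values of [spectral] ([eq_integral_hmax]).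

    The formula for the void probability is first proved when the inequality
    is only tested on finitely many cells of finite intensity, the level being
    constant on each cell ([prob_marks]), and then by dyadic refinement of the
    cells ([poisson_max]). *)

(** * Integrals against weighted laws and image laws *)

(** Tilted and conditional laws are prescribed on measurable sets by an integral
    against a density; this section extends such a formula from indicators to
    nonnegative functions, through simple functions and monotone convergence. *)
Section weighted_law.
Context d1 d2 (S : measurableType d1) (E : measurableType d2) (R : realType).
Variables (mu : {measure set S -> \bar R}) (nu : {measure set E -> \bar R}).
Variables (X : S -> E) (rho : S -> \bar R).
Hypotheses (mX : measurable_fun setT X) (mrho : measurable_fun setT rho).
Hypothesis rho0 : forall s, 0 <= rho s.
Hypothesis rho_fin : forall s, rho s \is a fin_num.
Hypothesis nuE : forall A, measurable A ->
  nu A = \int[mu]_s (rho s * (\1_(X @^-1` A) s)%:E).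

Import HBNNSimple.

Let weighted_law_nnsfun (h : {nnsfun E >-> R}) :
  \int[nu]_x (h x)%:E = \int[mu]_s (rho s * (h (X s))%:E).
Proof.
have mhX r : measurable_fun setT (fun s => (\1_(h @^-1` [set r]) (X s))%:E : \bar R).
  by apply/measurable_EFinP; apply: measurableT_comp.
under eq_integral do rewrite fimfunE -fsumEFin//.
rewrite ge0_integral_fsum//; last 2 first.
- by move=> r; exact/measurable_EFinP/measurable_funM.
- by move=> r x _; rewrite nnfun_muleindic_ge0.
transitivity (\int[mu]_s (\sum_(r \in range h)
    (rho s * (r * \1_(h @^-1` [set r]) (X s))%:E))); last first.
  apply: eq_integral => s _; rewrite -ge0_mule_fsumr.
    by rewrite fsumEFin// -(fimfunE h).
  by move=> r; exact: nnfun_muleindic_ge0.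
rewrite ge0_integral_fsum//; last 2 first.
- move=> r; apply: emeasurable_funM => //.
  apply/measurable_EFinP; apply: measurable_funM => //; exact/measurable_EFinP/mhX.
- by move=> r s _; rewrite mule_ge0// nnfun_muleindic_ge0.
apply: eq_fsbigr => r /[!inE] -[x _ <-].
rewrite integralZl_indic_nnsfun// integral_indic//= setIT nuE//.
rewrite -ge0_integralZl//.
- by apply: eq_integral => s _; rewrite EFinM muleCA.
- by apply: emeasurable_funM => //; exact: mhX.
- by move=> s _; rewrite mule_ge0// lee_fin.
- by rewrite lee_fin.
Qed.

Lemma weighted_law_integral (g : E -> \bar R) : measurable_fun setT g ->
  (forall x, 0 <= g x) -> \int[nu]_x g x = \int[mu]_s (rho s * g (X s)).
Proof.
move=> mg g0; pose h := nnsfun_approx measurableT mg.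
transitivity (limn (fun n => \int[nu]_x (h n x)%:E)).
  rewrite -monotone_convergence//=.
  - by apply: eq_integral => x _; apply/esym/cvg_lim => //; exact: cvg_nnsfun_approx.
  - by move=> n; exact/measurable_EFinP.
  - by move=> n x _; rewrite lee_fin.
  - by move=> x _ a b ab; rewrite lee_fin; exact/lefP/nd_nnsfun_approx.
under eq_fun do rewrite weighted_law_nnsfun.
rewrite -monotone_convergence//=.
- apply: eq_integral => s _; apply/cvg_lim => //.
  have hg : (h n (X s))%:E @[n --> \oo] --> g (X s) by exact: cvg_nnsfun_approx.
  by apply: cvgeZl => //; exact: hg.
- by move=> n; apply: emeasurable_funM => //; apply/measurable_EFinP; exact: measurableT_comp.
- by move=> n x _; rewrite mule_ge0// lee_fin.
- by move=> x _ a b ab; rewrite lee_wpmul2l// lee_fin; exact/lefP/nd_nnsfun_approx.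
Qed.
End weighted_law.

Lemma eq_law_integral (R : realType) d1 d2 d (O1 : measurableType d1) (O2 : measurableType d2)
    (E : measurableType d) (P1 : probability O1 R) (P2 : probability O2 R)
    (X1 : O1 -> E) (X2 : O2 -> E) :
  measurable_fun setT X1 -> measurable_fun setT X2 ->
  (forall A, measurable A -> P1 (X1 @^-1` A) = P2 (X2 @^-1` A)) ->
  forall g : E -> \bar R, measurable_fun setT g -> (forall x, 0 <= g x) ->
  \int[P1]_w g (X1 w) = \int[P2]_w g (X2 w).
Proof.
move=> mX1 mX2 X12 g mg g0.
pose Y1 : {mfun O1 >-> E} := HB.pack X1 (isMeasurableFun.Build _ _ _ _ _ mX1).
pose Y2 : {mfun O2 >-> E} := HB.pack X2 (isMeasurableFun.Build _ _ _ _ _ mX2).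
transitivity (\int[distribution P1 Y1]_x g x); first by rewrite ge0_integral_distribution.
transitivity (\int[distribution P2 Y2]_x g x); last by rewrite ge0_integral_distribution.
by apply: eq_measure_integral => A mA _; exact: X12.
Qed.

Lemma eq_measure_off_null (R : realType) d (O : measurableType d) (P : probability O R)
    (M A1 A2 : set O) : measurable M -> P M = 0 -> measurable A1 -> measurable A2 ->
  (forall w, ~ M w -> (A1 w <-> A2 w)) -> P A1 = P A2.
Proof.
move=> mM M0 mA1 mA2 A12.
have off A : measurable A -> P A = P (A `\` M).
  move=> mA; rewrite (measureDI P mA mM) [X in _ + X](_ : _ = 0) ?adde0//.
  apply/eqP; rewrite eq_le measure_ge0 andbT -M0 le_measure ?inE//.
  exact: measurableI.
rewrite (off _ mA1) (off _ mA2); congr (P _).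
by apply/seteqP; split => w /= [Aw Mw]; split => //; apply/(A12 w Mw).
Qed.

(** * Laws determined by lower orthants *)

(** Lists of pairs instead of tuples make these events closed under intersection
    by concatenation, with the empty list giving the whole space; no bound is
    put on the other coordinates, so the value +oo needs no separate treatment. *)
Definition below (R : realType) (T : Type) (l : seq (T * R)) (f : T -> \bar R) : bool :=
  all (fun p => f p.1 <= p.2%:E) l.

Section eq_law_below.
Context d1 d2 d (O1 : measurableType d1) (O2 : measurableType d2)
  (E : measurableType d) (R : realType).
Variables (P1 : probability O1 R) (P2 : probability O2 R).
Variables (T : Type) (ev : T -> E -> \bar R).
Hypothesis measurableE : (measurable : set (set E)) =
  <<s \bigcup_t preimage_set_system setT (ev t) measurable >>.

Lemma measurable_eval t : measurable_fun setT (ev t).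
Proof.
move=> _ B mB; rewrite measurableE; apply: sub_sigma_algebra.
by exists t => //; exists B.
Qed.

Lemma measurable_fun_evals d' (S : measurableType d') (X : S -> E) :
  (forall t, measurable_fun setT (ev t \o X)) -> measurable_fun setT X.
Proof.
move=> mX; apply: measurability measurableE _.
move=> _ [_ [t _ [B mB <-]] <-].
by rewrite !setTI -comp_preimage -[X in measurable X]setTI; exact: mX.
Qed.

Lemma measurable_below l : measurable [set y | below l (ev^~ y)].
Proof.
elim: l => [|p l ih]; first by rewrite [X in measurable X](_ : _ = setT)//; apply/seteqP; split.
rewrite [X in measurable X](_ : _ =
  (setT `&` [set y | ev p.1 y <= p.2%:E]) `&` [set y | below l (ev^~ y)]); last first.
  by apply/seteqP; split => y /= => [/andP[]|[[_ ? ?]]] //; apply/andP.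
apply: measurableI => //; apply: emeasurable_fun_infty_c => //.
exact: measurable_eval.
Qed.

(** The sets defined by [below] form a pi-system, and they generate because the
    complements of the half-lines [-oo, r] generate the Borel sets. *)
Lemma eq_law_below (X1 : O1 -> E) (X2 : O2 -> E) :
  measurable_fun setT X1 -> measurable_fun setT X2 ->
  (forall l, P1 [set w | below l (ev^~ (X1 w))] =
             P2 [set w | below l (ev^~ (X2 w))]) ->
  forall A, measurable A -> P1 (X1 @^-1` A) = P2 (X2 @^-1` A).
Proof.
move=> mX1 mX2 X12 A mA.
pose Y1 : {mfun O1 >-> E} := HB.pack X1 (isMeasurableFun.Build _ _ _ _ _ mX1).
pose Y2 : {mfun O2 >-> E} := HB.pack X2 (isMeasurableFun.Build _ _ _ _ _ mX2).
pose G := [set [set y | below l (ev^~ y)] | l in [set: seq (T * R)]].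
(* The event of the empty list is the whole space and serves as a cover. *)
apply: (@g_sigma_algebra_measure_unique _ _ _ G _ (fun=> setT) _ _
  (distribution P1 Y1) (distribution P2 Y2)).
- by move=> _ [l _ <-]; exact: measurable_below.
- by move=> _; exists [::] => //; apply/seteqP; split.
- by rewrite bigcup_const//; exists 0%N.
- move=> _ _ [l1 _ <-] [l2 _ <-]; exists (l1 ++ l2) => //.
  by apply/seteqP; split => y /=; rewrite /below all_cat => /andP.
- by move=> _ [l _ <-]; exact: X12.
- by move=> _; rewrite -ge0_fin_numE//; exact: fin_num_measure.
move: A mA; rewrite measurableE; apply: smallest_sub.
  exact: smallest_sigma_algebra.
move=> _ [t _ [B mB <-]].
have : preimage_set_system setT (ev t)
    (<<s @ErealGenOInfty.G R >>) (setT `&` ev t @^-1` B).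
  exists B => //; move: mB; rewrite /measurable/=.
  by rewrite ErealGenOInfty.measurableE.
rewrite -g_sigma_preimageE; apply: smallest_sub => //.
move=> _ [_ [r ->] <-]; rewrite setTI.
rewrite (_ : _ @^-1` _ = ~` [set y | below [:: (t, r)] (ev^~ y)]); last first.
  apply/seteqP; split => y /=; rewrite in_itv/= andbT andbT ltNge => /negP//.
rewrite -setTD; apply: sigma_algebraCD.
by apply: sub_sigma_algebra; exists [:: (t, r)].
Qed.

End eq_law_below.

Lemma measurable_tupleE (R : realType) n :
  (measurable : set (set (n.-tuple (\bar R)))) =
  <<s \bigcup_i preimage_set_system setT (fun y : n.-tuple (\bar R) => tnth y i) measurable >>.
Proof.
rewrite {1}/measurable/= /g_sigma_preimage; congr (<<s _ >>).
rewrite -bigcup_seq; congr bigcup.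
by apply/seteqP; split => i //= _; rewrite mem_index_enum.
Qed.

Lemma measurable_FminfE (R : realType) (T : zmodType) :
  (measurable : set (set (Fminf R T))) =
  <<s \bigcup_t preimage_set_system setT (fun f : Fminf R T => f t) measurable >>.
Proof. by []. Qed.

Lemma below_map (R : realType) (T T' : Type) (h : T -> T') (l : seq (T * R)) (f : T' -> \bar R) :
  below [seq (h p.1, p.2) | p <- l] f = below l (f \o h).
Proof. by rewrite /below all_map. Qed.

(** Together with the converse [below_fdd_eq], this replaces finite dimensional
    distributions by the probabilities of lower orthants. *)
Lemma fdd_eq_below (R : realType) (T : Type)
    d1 (O1 : measurableType d1) (P1 : probability O1 R) (X1 : T -> O1 -> \bar R)
    d2 (O2 : measurableType d2) (P2 : probability O2 R) (X2 : T -> O2 -> \bar R) :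
  fdd_eq P1 X1 P2 X2 -> forall l : seq (T * R),
  P1 [set w | below l (X1 ^~ w)] = P2 [set w | below l (X2 ^~ w)].
Proof.
move=> X12 l; pose s := [tuple (tnth (in_tuple l) i).1 | i < size l].
pose l' := [seq (i, (tnth (in_tuple l) i).2) | i <- enum 'I_(size l)].
have lE (X : T -> \bar R) : below l X =
    below l' (fun i => tnth [tuple X (tnth s i) | i < size l] i).
  rewrite /below /l' all_map.
  transitivity (all (fun p => X p.1 <= p.2%:E)
      [seq tnth (in_tuple l) i | i <- enum 'I_(size l)]).
    by rewrite map_tnth_enum.
  by rewrite all_map; apply: eq_all => i /=; rewrite !tnth_mktuple.
have setE (O : Type) (X : T -> O -> \bar R) : [set w | below l (X ^~ w)] =
    [set w | [set y | below l' (fun i => tnth y i)] [tuple X (tnth s i) w | i < size l]].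
  by apply: eq_set => w; rewrite lE.
rewrite !setE; apply: X12.
exact: measurable_below (measurable_tupleE R (size l)) _.
Qed.

Lemma below_fdd_eq (R : realType) (T : Type)
    d1 (O1 : measurableType d1) (P1 : probability O1 R) (X1 : T -> O1 -> \bar R)
    d2 (O2 : measurableType d2) (P2 : probability O2 R) (X2 : T -> O2 -> \bar R) :
  (forall t, measurable_fun setT (X1 t)) -> (forall t, measurable_fun setT (X2 t)) ->
  (forall l : seq (T * R),
    P1 [set w | below l (X1 ^~ w)] = P2 [set w | below l (X2 ^~ w)]) ->
  fdd_eq P1 X1 P2 X2.
Proof.
move=> mX1 mX2 X12 n t B mB.
apply: (eq_law_below (measurable_tupleE R n)
  (X1 := fun w => [tuple X1 (tnth t i) w | i < n])
  (X2 := fun w => [tuple X2 (tnth t i) w | i < n])) => //.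
- apply/measurable_fun_tnthP => i; rewrite (_ : _ \o _ = X1 (tnth t i))//.
  by apply/funext => w /=; rewrite tnth_mktuple.
- apply/measurable_fun_tnthP => i; rewrite (_ : _ \o _ = X2 (tnth t i))//.
  by apply/funext => w /=; rewrite tnth_mktuple.
- move=> l.
  have setE (O : Type) (X : T -> O -> \bar R) :
      [set w | below l ((fun y : n.-tuple (\bar R) => fun i => tnth y i)
                 [tuple X (tnth t i) w | i < n])] =
      [set w | below [seq (tnth t p.1, p.2) | p <- l] (X ^~ w)].
    apply: eq_set => w; rewrite below_map; congr (is_true (below l _)).
    by apply/funext => i; rewrite tnth_mktuple.
  by rewrite !setE.
Qed.

Lemma sigma_generated_below (R : realType) d (O : measurableType d) (T : Type)
    (X : T -> O -> \bar R) (l : seq (T * R)) :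
  sigma_generated X [set w | below l (X ^~ w)].
Proof.
rewrite /sigma_generated; set G := \bigcup_i _.
have mX t : measurable_fun (setT : set (g_sigma_algebraType G)) (X t).
  by move=> _ B mB; apply: sub_sigma_algebra; exists t => //; exists B.
elim: l => [|p l ih].
  by rewrite (_ : [set _ | _] = setT); [exact: (@measurableT _ (g_sigma_algebraType G))|apply/seteqP; split].
rewrite [X in _ X](_ : _ = (setT `&` [set w | X p.1 w <= p.2%:E]) `&` [set w | below l (X ^~ w)]).
  apply: (@measurableI _ (g_sigma_algebraType G)) => //.
  exact: emeasurable_fun_infty_c.
by apply/seteqP; split => y /= => [/andP[]|[[_ ? ?]]] //; apply/andP.
Qed.

(** * A Poisson process with independent marks, on finitely many cells *)

Section finite_valued.
Context d (O : measurableType d) (R : realType) (P : {measure set O -> \bar R}).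
Variables (F : finType) (S : O -> F).
Hypothesis mS : forall s, measurable [set w | S w = s].

Lemma measure_partition (A : set O) : measurable A ->
  P A = \sum_s P (A `&` [set w | S w = s]).
Proof.
move=> mA.
have mAS s : measurable (A `&` [set w | S w = s]) by exact: measurableI.
transitivity (\int[P]_w (\1_A w)%:E); first by rewrite integral_indic// setIT.
transitivity (\int[P]_w (\sum_s (\1_(A `&` [set w | S w = s]) w)%:E)).
  apply: eq_integral => w _; rewrite (bigD1 (S w))//= big1 ?adde0.
    by rewrite indicI /= [\1_[set _ | _] w]indicE mem_set// mulr1.
  move=> s sS; rewrite indicE memNset//= => -[_ /esym/eqP].
  by rewrite (negbTE sS).
rewrite ge0_integral_sum//.
- by apply: eq_bigr => s _; rewrite integral_indic// setIT.
- by move=> s; exact/measurable_EFinP/measurable_indic.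
Qed.

Lemma integral_finite_valued (g : F -> R) : (forall s, (0 <= g s)%R) ->
  \int[P]_w (g (S w))%:E = \sum_s (g s)%:E * P [set w | S w = s].
Proof.
move=> g0.
transitivity (\int[P]_w (\sum_s ((g s)%:E * (\1_[set w | S w = s] w)%:E))).
  apply: eq_integral => w _; rewrite (bigD1 (S w))//= big1 ?adde0.
    by rewrite indicE mem_set// mule1.
  by move=> s sS; rewrite indicE memNset ?mule0//= => /esym/eqP; rewrite (negbTE sS).
have mi s : measurable_fun setT (fun w => (\1_[set w | S w = s] w)%:E : \bar R).
  exact/measurable_EFinP/measurable_indic.
rewrite ge0_integral_sum//.
- by apply: eq_bigr => s _; rewrite ge0_integralZl// ?integral_indic ?setIT// lee_fin.
- by move=> s; exact: emeasurable_funM.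
- by move=> s w _; rewrite mule_ge0// lee_fin.
Qed.

End finite_valued.

(** The probability generating function of the Poisson law, as a limit of partial
    sums: this is the form in which it meets the truncated counts below. *)
Lemma cvg_poisson_pgf (R : realType) (l z : R) :
  (\sum_(n < M) z ^+ n * (expR (- l) * l ^+ n / n`!%:R))%R @[M --> \oo] -->
  expR (- (l * (1 - z))).
Proof.
have -> : expR (- (l * (1 - z))) = (expR (- l) * expR (l * z))%R.
  by rewrite -expRD; congr expR; ring.
rewrite (_ : (fun M => _) = (fun M => expR (- l) * series (exp_coeff (l * z)) M)%R).
  by apply: cvgMr; exact: is_cvg_series_exp_coeff.
apply/funext => M; rewrite /series/= big_mkord mulr_sumr; apply: eq_bigr => n _.
by rewrite /exp_coeff/= exprMn; ring.
Qed.

(** The cells [A i] have finite intensity, and the j-th point must satisfy [U j i]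
    when it falls in [A i], an event of probability [f i]. Conditionally on the
    points, the probability that all of the first J points comply is the product
    of the [f i] over the cells hit, which tends to the product of the
    [f i ^+ N_i], N_i being the number of points in [A i]. The N_i are
    independent Poisson variables, so that the expectation of the limit is the
    product of the generating functions. *)
Section poisson_marks.
Context d (O : measurableType d) (R : realType) (P : probability O R).
Variables (Q : nat -> O -> R) (PQ : poisson_point_process P Q).
Variables (N : nat) (A : 'I_N -> set R) (lam : 'I_N -> R).
Hypotheses (mA : forall i, measurable (A i)) (tA : trivIset setT A).
Hypothesis lamE : forall i, intensity (A i) = (lam i)%:E.
Variables (U : nat -> 'I_N -> set O) (f : 'I_N -> R).
Hypothesis mU : forall j i, measurable (U j i).
Hypothesis f01 : forall i, (0 <= f i <= 1)%R.

Definition cell_of (q : R) : option 'I_N := [pick i | q \in A i].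

Hypothesis indep_marks : forall J (s : {ffun 'I_J -> option 'I_N}),
  P [set w | forall j : 'I_J, cell_of (Q j w) = s j /\
       (forall i, s j = Some i -> U j i w)] =
  P [set w | forall j : 'I_J, cell_of (Q j w) = s j] *
  (\prod_(j < J) oapp f 1%R (s j))%:E.

Let mQ j : measurable_fun setT (Q j). Proof. by case: PQ. Qed.

Lemma cell_ofP q i : reflect (A i q) (cell_of q == Some i).
Proof.
apply: (iffP eqP); rewrite /cell_of.
  by case: pickP => // j qj [<-]; rewrite inE in qj.
case: pickP => [j qj Aiq|/(_ i) + Aiq]; last by rewrite mem_set.
congr Some; apply: contrapT => /eqP ji; move/trivIsetP: tA => /(_ j i Logic.I Logic.I ji).
by apply/eqP/set0P; exists q; split => //; rewrite inE in qj.
Qed.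

Lemma measurable_cell s : measurable [set q | cell_of q = s].
Proof.
have mSome i : measurable [set q | cell_of q = Some i].
  rewrite [X in measurable X](_ : _ = A i)//.
  by apply/seteqP; split => q /= => [/eqP/cell_ofP|/cell_ofP/eqP].
case: s => [//|].
rewrite [X in measurable X](_ : _ = ~` \big[setU/set0]_i [set q | cell_of q = Some i]).
  by apply: measurableC; apply: bigsetU_measurable.
rewrite -bigcup_seq; apply/seteqP; split => q /=.
  by move=> qN [i _] /=; rewrite qN.
move=> h; case E : (cell_of q) => [i|//]; exfalso; apply: h; exists i => //=.
by rewrite mem_index_enum.
Qed.

Let mcells J (s : {ffun 'I_J -> option 'I_N}) :
  measurable [set w | [ffun j : 'I_J => cell_of (Q j w)] = s].
Proof.
rewrite [X in measurable X](_ : _ =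
    \big[setI/setT]_(j < J) (setT `&` Q j @^-1` [set q | cell_of q = s j])).
  by apply: bigsetI_measurable => j _; apply: mQ => //; exact: measurable_cell.
rewrite -bigcap_seq; apply/seteqP; split => w /=.
  by move=> /ffunP sE j _; split => //=; rewrite -sE ffunE.
move=> h; apply/ffunP => j; rewrite ffunE.
by have [] := h j (mem_index_enum _).
Qed.

Let E J := [set w | forall j i, (j < J)%N -> A i (Q j w) -> U j i w].

Let mE J : measurable (E J).
Proof.
rewrite [X in measurable X](_ : _ = \big[setI/setT]_(j < J)
    \big[setI/setT]_i (~` (setT `&` Q j @^-1` A i) `|` U j i)).
  apply: bigsetI_measurable => j _; apply: bigsetI_measurable => i _.
  by apply: measurableU => //; apply: measurableC; exact: mQ.
rewrite -bigcap_seq; apply/seteqP; split => w /=.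
  move=> h j _; rewrite -bigcap_seq => i _ /=.
  have [AQ|AQ] := pselect (A i (Q j w)); first by right; exact: h.
  by left; case.
move=> h j i jJ AQ; have /= := h (Ordinal jJ) (mem_index_enum _).
rewrite -bigcap_seq => /(_ i (mem_index_enum _)) [] //.
by rewrite setTI => /(_ AQ).
Qed.

Let psi J w := (\prod_(j < J) oapp f 1%R (cell_of (Q j w)))%R.

(** There are finitely many ways of distributing J points over the cells and the
    complement of their union; on each of them the marks are independent of the
    points. *)
Lemma prob_first_points J : P (E J) = \int[P]_w (psi J w)%:E.
Proof.
rewrite (measure_partition P (@mcells J))//.
transitivity (\sum_(s : {ffun 'I_J -> option 'I_N})
    (\prod_(j < J) oapp f 1%R (s j))%:E *
    P [set w | [ffun j : 'I_J => cell_of (Q j w)] = s]).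
  apply: eq_bigr => s _; rewrite muleC.
  have -> : [set w | [ffun j : 'I_J => cell_of (Q j w)] = s] =
      [set w | forall j : 'I_J, cell_of (Q j w) = s j].
    apply/seteqP; split => w /=; first by move=> <- j; rewrite ffunE.
    by move=> h; apply/ffunP => j; rewrite ffunE.
  rewrite -indep_marks; congr (P _); apply/seteqP; split => w /=.
    move=> [Ew sw] j; split => // i sji; apply: Ew => //.
    by apply/cell_ofP; rewrite sw sji.
  move=> h; split; last by move=> j; have [] := h j.
  move=> j i jJ /cell_ofP/eqP AQ; have [h1 h2] := h (Ordinal jJ).
  by apply: h2; rewrite -h1.
rewrite -(integral_finite_valued P (@mcells J)
  (g := fun s => (\prod_(j < J) oapp f 1%R (s j))%R)).
  by apply: eq_integral => w _; congr EFin; apply: eq_bigr => j _; rewrite ffunE.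
move=> s; apply: prodr_ge0 => j _; case: (s j) => //= i.
by have /andP[] := f01 i.
Qed.

Let cnt i w := counting_process Q (A i) w.

Lemma measurable_counting i : measurable_fun setT (cnt i).
Proof.
apply: ge0_emeasurable_sum => // j _.
by apply/measurable_EFinP; apply: measurableT_comp => //; exact: measurable_indic.
Qed.

Let mcnt i (n : nat) : measurable [set w | cnt i w = n%:R%:E].
Proof.
rewrite [X in measurable X](_ : _ = setT `&` cnt i @^-1` [set n%:R%:E]); last first.
  by apply/seteqP; split => w //= -[].
exact: measurable_counting.
Qed.

Let pois i n := (expR (- lam i) * lam i ^+ n / n`!%:R)%R.

(** The product of the [f i ^+ N_i] on the event that all counts are below M; the
    truncation makes it a finite sum over the possible values of the counts. *)
Let phi M w := (\prod_i \sum_(n < M) f i ^+ n * \1_[set w | cnt i w = n%:R%:E] w)%R.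

Lemma prob_counts M (s : {ffun 'I_N -> 'I_M}) :
  P [set w | forall i, cnt i w = (s i)%:R%:E] = (\prod_i pois i (s i))%:E.
Proof.
have [_ _ pois_cnt /(_ _ _ mA tA) indep_cnt] := PQ.
have := @indep_cnt (index_enum 'I_N) (fun i => [set w | cnt i w = (s i)%:R%:E])
  (index_enum_uniq _).
rewrite [X in P X](_ : _ = [set w | forall i, cnt i w = (s i)%:R%:E]); last first.
  by apply/seteqP; split => w /= h i //; [apply: h => /=; rewrite mem_index_enum|move=> _; exact: h].
move=> ->; last first.
  by move=> i _; exists [set (s i)%:R%:E] => //; rewrite setTI.
by congr EFin; apply: eq_bigr => i _; rewrite (pois_cnt _ _ _ (mA i) (lamE i)).
Qed.

Lemma integral_counts M :
  \int[P]_w (phi M w)%:E = (\prod_i \sum_(n < M) f i ^+ n * pois i n)%:E.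
Proof.
pose C (s : {ffun 'I_N -> 'I_M}) := [set w | forall i, cnt i w = (s i)%:R%:E].
have mC s : measurable (C s).
  rewrite /C [X in measurable X](_ : _ = \big[setI/setT]_i [set w | cnt i w = (s i)%:R%:E]).
    by apply: bigsetI_measurable.
  rewrite -bigcap_seq; apply/seteqP; split => w /= h i; first by move=> _; exact: h.
  by apply: h => /=; rewrite mem_index_enum.
have cs0 (s : {ffun 'I_N -> 'I_M}) : (0 <= \prod_i f i ^+ s i)%R.
  by apply: prodr_ge0 => i _; rewrite exprn_ge0//; case/andP: (f01 i).
have mi s : measurable_fun setT (fun w => (\1_(C s) w)%:E : \bar R).
  exact/measurable_EFinP/measurable_indic.
transitivity (\int[P]_w
   (\sum_(s : {ffun 'I_N -> 'I_M}) (\prod_i f i ^+ s i)%:E * (\1_(C s) w)%:E)).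
  apply: eq_integral => w _; rewrite /phi bigA_distr_bigA/= -sumEFin.
  apply: eq_bigr => s _; rewrite -EFinM big_split/=; congr (_ * _)%:E.
  rewrite indicE; have [Cs|Cs] := pselect (C s w).
    rewrite (mem_set Cs). by rewrite big1// => i _; rewrite indicE mem_set//; exact: Cs.
  have [i csi] : exists i, cnt i w <> (s i)%:R%:E by apply/existsNP.
  by rewrite (memNset Cs) (bigD1 i)//= indicE memNset ?mul0r.
rewrite ge0_integral_sum//; last 2 first.
- by move=> s; exact: emeasurable_funM.
- by move=> s w _; rewrite mule_ge0// lee_fin.
rewrite bigA_distr_bigA/= -sumEFin; apply: eq_bigr => s _.
rewrite ge0_integralZl//; last by rewrite lee_fin.
rewrite integral_indic// setIT.
apply: etrans (congr1 (fun z => (\prod_i f i ^+ s i)%:E * z) (prob_counts s)) _.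
by rewrite -EFinM -big_split.
Qed.

Let counts_finite : \forall w \ae P, forall i, exists n, cnt i w = n%:R%:E.
Proof.
apply: filter_forall => i.
pose B := \bigcup_n [set w | cnt i w = n%:R%:E].
have mB : measurable B by exact: bigcupT_measurable.
suff PB : P B = 1.
  exists (~` B); split; first exact: measurableC.
    by rewrite probability_setC// PB subee.
  by move=> w /= h [n _ /= ?]; apply: h; exists n.
rewrite measure_bigcup//; last first.
  move=> n m _ _ [w [/= -> /eqP]]; rewrite eqe eqr_nat => /eqP.
  by [].
have [_ _ pois_cnt _] := PQ.
rewrite (eq_eseriesl (Q := xpredT)) => [|n]; last by rewrite in_setT.
apply/cvg_lim => //.
rewrite (_ : (fun n => _) = EFin \o (fun M => \sum_(n < M) 1 ^+ n * pois i n)%R).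
  apply: cvg_EFin; first by apply: nearW.
  have := @cvg_poisson_pgf R (lam i) 1; rewrite subrr mulr0 oppr0 expR0.
  exact.
apply/funext => M /=; rewrite big_mkord -sumEFin; apply: eq_bigr => n _.
by rewrite expr1n mul1r (pois_cnt _ _ _ (mA i) (lamE i)).
Qed.

Let eventually_cnt i n w : cnt i w = n%:R%:E ->
  \forall M \near \oo, (\sum_(j < M) (Q j w \in A i))%N = n.
Proof.
move=> cn.
have : ((\sum_(j < M) (Q j w \in A i))%N%:R : R)@[M --> \oo] --> (n%:R : R).
  have := is_cvg_nneseries (u_ := fun j => \d_(Q j w) (A i)) (P := xpredT) (N := 0%N)
    (fun n _ _ => measure_ge0 _ _).
  move=> h.
  have {h} : \sum_(0 <= j < M) \d_(Q j w) (A i) @[M --> \oo] --> (n%:R%:E : \bar R).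
    by rewrite -cn; exact: h.
  move=> /fine_cvgP[_].
  apply: cvg_trans; apply: near_eq_cvg; near=> M => /=.
  rewrite big_mkord natr_sum -[RHS]/(fine (_)%:E) -sumEFin; congr fine.
move/cvgrPdist_lt => /(_ 1%R ltr01); apply: filterS => M; rewrite ltr_norml => /andP[nc1 nc2].
have ltn_R a b : (a%:R - b%:R < 1 :> R)%R -> (a <= b)%N.
  by move=> ab; rewrite -ltnS -(ltr_nat R) -natr1; lra.
by apply/eqP; rewrite eqn_leq; apply/andP; split; apply: ltn_R; lra.
Unshelve. all: by end_near. Qed.

(** Only finitely many points lie in the union of the cells, so the two
    approximations of the product of the [f i ^+ N_i] are eventually equal to
    it. *)
Let phi_psi w : (forall i, exists n, cnt i w = n%:R%:E) ->
  \forall M \near \oo, phi M w = psi M w.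
Proof.
move=> /choice[n cn].
have cntM : \forall M \near \oo, forall i, (\sum_(j < M) (Q j w \in A i))%N = n i.
  by apply: filter_forall => i; exact: eventually_cnt.
have nM : \forall M \near \oo, forall i, (n i < M)%N.
  by apply: filter_forall => i; exists (n i).+1.
near=> M.
have cM : forall i, (\sum_(j < M) (Q j w \in A i))%N = n i by near: M.
have nltM : forall i, (n i < M)%N by near: M.
transitivity (\prod_i f i ^+ n i)%R.
  apply: eq_bigr => i _; rewrite (bigD1 (Ordinal (nltM i)))//= big1 ?addr0.
    by rewrite indicE mem_set// mulr1.
  move=> m /eqP mn; rewrite indicE memNset ?mulr0//= cn => -[] /eqP.
  by rewrite eqr_nat => /eqP nm; apply: mn; apply/val_inj.
transitivity (\prod_i \prod_(j < M) f i ^+ (Q j w \in A i))%R.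
  by apply: eq_bigr => i _; rewrite -cM prodrXr.
rewrite exchange_big/=; apply: eq_bigr => j _.
case celQ : (cell_of _) => [i|] /=.
  rewrite (bigD1 i)//= big1 ?mulr1.
    by move/eqP : celQ => /cell_ofP AQ; rewrite mem_set.
  move=> k ki; rewrite memNset// => /cell_ofP; rewrite celQ => /eqP[ik].
  by rewrite ik eqxx in ki.
rewrite big1// => i _; rewrite memNset// => /cell_ofP.
by rewrite celQ.
Unshelve. all: by end_near. Qed.

Let psi01 M w : (0 <= psi M w <= 1)%R.
Proof.
have h (o : option 'I_N) : (0 <= oapp f 1 o <= 1)%R by case: o => [i|]/=; rewrite ?ler01 ?lexx.
apply/andP; split; first by apply: prodr_ge0 => j _; case/andP: (h (cell_of (Q j w))).
by apply: prodr_ile1 => j _.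
Qed.

Let phi01 M w : (0 <= phi M w <= 1)%R.
Proof.
suff h i : (0 <= \sum_(n < M) f i ^+ n * \1_[set w | cnt i w = n%:R%:E] w <= 1)%R.
  apply/andP; split; first by apply: prodr_ge0 => i _; case/andP: (h i).
  by apply: prodr_ile1 => i _.
have /andP[f0 f1] := f01 i.
apply/andP; split; first by apply: sumr_ge0 => n _; rewrite mulr_ge0// exprn_ge0.
have [[n cn]|/forallNP cN] := pselect (exists n : 'I_M, cnt i w = n%:R%:E).
  rewrite (bigD1 n)//= big1 ?addr0.
    by rewrite indicE mem_set// mulr1 exprn_ile1.
  move=> m /eqP mn; rewrite indicE memNset ?mulr0//= cn => -[] /eqP.
  by rewrite eqr_nat => /eqP nm; apply: mn; apply/val_inj.
by rewrite big1// => n _; rewrite indicE memNset ?mulr0//; exact: cN.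
Qed.

Let mpsi M : measurable_fun setT (psi M).
Proof.
apply: measurable_prod => j _.
apply: (measurableT_comp (f := fun q => oapp f 1%R (cell_of q))) (mQ j).
rewrite (_ : (fun q => _) = (fun q => \sum_s oapp f 1 s * \1_[set q | cell_of q = s] q)%R).
  apply: measurable_sum => s.
  by apply: measurable_funM => //; apply: measurable_indic; exact: measurable_cell.
apply/funext => q; rewrite (bigD1 (cell_of q))//= big1 ?addr0.
  by rewrite indicE mem_set// mulr1.
by move=> s /eqP sq; rewrite indicE memNset ?mulr0//= => /esym.
Qed.

Let mphi M : measurable_fun setT (phi M).
Proof.
apply: measurable_prod => i _; apply: measurable_sum => n.
by apply: measurable_funM => //; exact: measurable_indic.
Qed.

Lemma prob_marks :
  P [set w | forall j i, A i (Q j w) -> U j i w] =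
  (expR (- \sum_i lam i * (1 - f i)))%:E.
Proof.
have -> : [set w | forall j i, A i (Q j w) -> U j i w] = \bigcap_J E J.
  apply/seteqP; split => w /= h; first by move=> J _ j i _; exact: h.
  by move=> j i; apply: (h j.+1).
have PE : P (E J) @[J --> \oo] --> P (\bigcap_J E J).
  apply: nonincreasing_cvg_mu => //.
  - by rewrite -ge0_fin_numE//; exact: fin_num_measure.
  - exact: bigcapT_measurable.
  - by move=> m n mn; apply/subsetPset => w /= h j i jm; apply: h; exact: leq_trans mn.
rewrite -(cvg_lim _ PE)//; apply/cvg_lim => //.
under eq_fun do rewrite prob_first_points.
have phiL : \int[P]_w (phi M w)%:E @[M --> \oo] --> (expR (- \sum_i lam i * (1 - f i)))%:E.
  under eq_fun do rewrite integral_counts.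
  apply: cvg_EFin; first exact: nearW.
  rewrite -sumrN expR_sum.
  apply: cvg_big => [|i _]; first exact: mul_continuous.
  exact: cvg_poisson_pgf.
(* Both products lie in [0, 1] and almost surely end up equal. *)
have diff : \int[P]_w (psi M w - phi M w)%:E @[M --> \oo] --> 0.
  have [|||||_ _] := @dominated_convergence _ _ _ P setT measurableT
    (fun M w => (psi M w - phi M w)%:E) (cst 0) (cst 1).
  - by move=> M; apply/measurable_EFinP; exact: measurable_funB.
  - exact: measurable_cst.
  - apply: filterS counts_finite => w cw _.
    apply: cvg_near_cst; apply: filterS (phi_psi cw) => M ->.
    by rewrite subrr.
  - exact: finite_measure_integrable_cst.
  - apply: nearW => w M _ /=; rewrite lee_fin.
    have /andP[? ?] := psi01 M w; have /andP[? ?] := phi01 M w.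
    by rewrite ler_norml; apply/andP; split; lra.
  by rewrite integral0.
have def_sum : (0 : \bar R) +? (expR (- \sum_i lam i * (1 - f i)))%:E.
  exact: fin_num_adde_defr.
have sumL : \int[P]_w (psi M w - phi M w)%:E + \int[P]_w (phi M w)%:E @[M --> \oo]
    --> (expR (- \sum_i lam i * (1 - f i)))%:E.
  rewrite -[X in _ --> X]add0e; exact: cvgeD def_sum diff phiL.
apply: cvg_trans sumL; apply: near_eq_cvg; apply: nearW => M.
have bounded_int (g : O -> R) : measurable_fun setT g -> (forall w, `|g w| <= 1)%R ->
    P.-integrable setT (EFin \o g).
  move=> mg g1; apply: (@le_integrable _ _ _ P setT measurableT _ (EFin \o cst 1%R)) => //.
  - exact/measurable_EFinP.
  - by move=> w _ /=; rewrite lee_fin normr1.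
  - exact: finite_measure_integrable_cst.
rewrite -integralD//=.
- by apply: eq_integral => w _; rewrite -EFinD subrK.
- apply: bounded_int; first exact: measurable_funB.
  move=> w; have /andP[? ?] := psi01 M w; have /andP[? ?] := phi01 M w.
  by rewrite ler_norml; apply/andP; split; lra.
- apply: bounded_int => // w; have /andP[? ?] := phi01 M w.
  by rewrite ler_norml; apply/andP; split; lra.
Qed.

End poisson_marks.

(** * Refining the cells *)

(** The map q |-> e^{-q} sends the intensity e^{-q} dq to Lebesgue measure. *)
Lemma intensity_level (R : realType) (a b : R) : (0 < a)%R -> (a < b)%R ->
  intensity [set q : R | a < expR (- q) <= b]%R = (b - a)%:E.
Proof.
move=> a0 ab; have b0 := lt_trans a0 ab.
have -> : [set q : R | a < expR (- q) <= b]%R = `[(- ln b)%R, (- ln a)%R[%classic.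
  apply/seteqP; split => q /=; rewrite in_itv/=.
    move=> /andP[aq qb]; rewrite -{1}[q]opprK lerN2 ltrNr -[(- q)%R]expRK.
    by rewrite ler_ln ?ltr_ln ?posrE ?expR_gt0// aq qb.
  move=> /andP[bq qa]; rewrite -[a]lnK ?posrE// -[b in (_ <= b)%R]lnK ?posrE//.
  by rewrite ltr_expR ler_expR ltrNr qa lerNl bq.
have lnab : (- ln b < - ln a)%R by rewrite ltrN2 ltr_ln ?posrE.
have cE : continuous (fun x : R => expR (- x)).
  by move=> x; apply: continuous_comp; [exact: opp_continuous|exact: continuous_expR].
rewrite /intensity integral_itv_bndo_bndc; last first.
  apply/measurable_EFinP; apply: measurable_funTS.
  exact: continuous_measurable_fun.
rewrite (@continuous_FTC2 _ _ (fun x => - expR (- x))%R)//.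
- rewrite !opprK !lnK ?posrE// -EFinB; congr EFin; ring.
- exact: continuous_subspaceT.
- split.
  + by move=> z _; exact: ex_derive.
  + by apply/cvg_at_right_filter; apply: cvgN; exact: cE.
  + by apply/cvg_at_left_filter; apply: cvgN; exact: cE.
- move=> z _; rewrite derive1E derive_val.
  by rewrite mulrN1 opprK.
Qed.

Lemma nat_ceil (R : archiRealFieldType) (y : R) : (0 <= y)%R ->
  exists n, (y <= n%:R /\ n%:R < y + 1)%R.
Proof.
move=> y0.
have ex : exists n, (y <= n%:R)%R by exists (Num.bound y); rewrite ltW// archi_boundP.
exists (ex_minn ex); case: ex_minnP => -[|n] yn min; split => //.
  by rewrite ltr_pwDr.
rewrite -natr1 ltrD2r ltNge; apply/negP => /min.
by rewrite ltnn.
Qed.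

(** The lower sum with mesh [e] of h = \int_0^oo 1(x < h) dx, over the N cells
    following the first one. The first cell is left out because it would
    correspond to an unbounded interval of points. *)
Definition staircase (R : realType) (e : R) (N : nat) (h : R) : R :=
  (\sum_(i < N) e * (i.+2%:R * e < h)%R%:R)%R.

(** When n is the ceiling of h / e, the steps counted are those with index at
    most n - 3. *)
Lemma staircase_count (R : realType) (e : R) (N n : nat) (h : R) : (0 < e)%R ->
  (h / e <= n%:R)%R -> (n%:R < h / e + 1)%R ->
  staircase e N h = (e * (minn N (n - 2))%:R)%R.
Proof.
move=> e0 hn nh; rewrite /staircase -mulr_sumr -natr_sum; congr (_ * _%:R)%R.
elim: N => [|N ih]; first by rewrite big_ord0 min0n.
rewrite big_ord_recr/= ih.
have -> : (N.+2%:R * e < h)%R = (N.+2 < n)%N.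
  rewrite -ltr_pdivlMr//; apply/idP/idP => [Nh|Nn].
    by rewrite -(ltr_nat R) (lt_le_trans Nh).
  have : (N.+2%:R + 1 <= n%:R :> R)%R by rewrite natr1 ler_nat.
  lra.
rewrite /minn; case: ifPn; case: ifPn; case: (ltnP N.+2 n) => /=; lia.
Qed.

Lemma staircase_ge0 (R : realType) (e : R) N h : (0 <= e)%R -> (0 <= staircase e N h)%R.
Proof. by move=> e0; apply: sumr_ge0 => i _; rewrite mulr_ge0. Qed.

Lemma staircase_le (R : realType) (e : R) (N : nat) (h : R) : (0 < e)%R -> (0 <= h)%R ->
  (staircase e N h <= h)%R.
Proof.
move=> e0 h0.
have [n [hn nh]] := nat_ceil (divr_ge0 h0 (ltW e0)).
rewrite (staircase_count _ e0 hn nh) mulrC -ler_pdivlMr//.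
case: n => [|n] in hn nh *; first by rewrite minn0 divr_ge0// ltW.
apply: (@le_trans _ _ n%:R); first by rewrite ler_nat; lia.
by move: nh; rewrite -natr1 ltrD2r => /ltW.
Qed.

Lemma staircase_approx (R : realType) (e : R) (N : nat) (h : R) : (0 < e)%R -> (0 <= h)%R ->
  (h <= N%:R * e)%R -> (h - 2 * e <= staircase e N h)%R.
Proof.
move=> e0 h0 hN.
have [n [hn nh]] := nat_ceil (divr_ge0 h0 (ltW e0)).
rewrite (staircase_count _ e0 hn nh).
have nN : (n <= N)%N.
  rewrite -ltnS -(ltr_nat R) -natr1 (lt_le_trans nh)// lerD2r.
  by rewrite ler_pdivrMr.
rewrite (_ : minn N (n - 2) = (n - 2)%N); last by lia.
have : (n%:R - 2 <= (n - 2)%N%:R :> R)%R.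
  have [n2|n2] := leqP 2 n; first by rewrite natrB.
  rewrite (_ : (n - 2)%N = 0%N); last by lia.
  by rewrite subr_le0 ler_nat ltnW.
rewrite ler_pdivrMr// in hn; nra.
Qed.

Lemma cvg_half_expn (R : realType) : (2^-1 ^+ m)%R @[m --> \oo] --> (0%R : R).
Proof. by apply: cvg_expr; rewrite gtr0_norm ?invr_gt0// invf_lt1// ltr1n. Qed.

Lemma dyadic_range (R : realType) (m : nat) :
  ((4 ^ m)%:R * (2^-1 ^+ m) = (2 ^ m)%:R :> R)%R.
Proof.
by rewrite (_ : 4 = 2 * 2)%N// expnMn natrM [in LHS]natrX exprVn -mulrA mulfV ?mulr1 ?natrX// expf_neq0.
Qed.

Lemma cvg_staircase (R : realType) (h : R) : (0 <= h)%R ->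
  staircase (2^-1 ^+ m)%R (4 ^ m) h @[m --> \oo] --> h.
Proof.
move=> h0.
have e0 m : (0 < 2^-1 ^+ m :> R)%R by rewrite exprn_gt0// invr_gt0.
apply: (@squeeze_cvgr _ _ _ _ (fun m => h - 2 * 2^-1 ^+ m)%R (cst h)); last 2 first.
- rewrite -[X in _ --> X]subr0 -[X in (_ - X)%R](mulr0 2%R).
  by apply: cvgB; [exact: cvg_cst|apply: cvgMr; exact: cvg_half_expn].
- exact: cvg_cst.
exists (Num.bound h) => // m /= bm; rewrite staircase_le// andbT staircase_approx//.
rewrite dyadic_range; apply/ltW/(lt_le_trans (archi_boundP h0)).
by rewrite ler_nat (leq_trans bm)// ltnW// ltn_expl.
Qed.

Lemma sigma_generated_all (R : realType) d (O : measurableType d) (Q : nat -> O -> R)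
    J (B : 'I_J -> set R) : (forall j, measurable (B j)) ->
  sigma_generated Q [set w | forall j : 'I_J, B j (Q j w)].
Proof.
move=> mB; rewrite /sigma_generated.
set G := \bigcup_i _.
rewrite [X in _ X](_ : _ = \big[setI/setT]_(j < J) (setT `&` Q j @^-1` B j)).
  apply: (@bigsetI_measurable _ (g_sigma_algebraType G)) => j _.
  by apply: sub_sigma_algebra; exists (val j) => //; exists (B j).
rewrite -bigcap_seq; apply/seteqP; split => w /= h j; first by move=> _; split.
by have [] := h j (mem_index_enum _).
Qed.

(** Here [H_ j] is the mark of the j-th point, [H] a variable with the law of the
    marks, and the points e^{-Q_j} have unit rate on the positive half-line. The
    option in [indep_marks] tells for which of the first J indices the mark is
    constrained. *)
Section poisson_max.
Context d (O : measurableType d) d' (O' : measurableType d') (R : realType).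
Variables (P : probability O R) (P' : probability O' R).
Variables (Q : nat -> O' -> R) (PQ : poisson_point_process P' Q).
Variables (H : O -> R) (H_ : nat -> O' -> R).
Hypotheses (mH : measurable_fun setT H) (H0 : forall w, (0 <= H w)%R).
Hypothesis iH : P.-integrable setT (EFin \o H).
Hypothesis mH_ : forall j, measurable_fun setT (H_ j).
Hypothesis indep_marks : forall J (D : set O') (o : 'I_J -> option R),
  sigma_generated Q D -> (forall j r, o j = Some r -> (0 < r)%R) ->
  P' (D `&` [set w | forall (j : 'I_J) r, o j = Some r -> (H_ j w <= r)%R]) =
  P' D * (\prod_(j < J) oapp (fun r => fine (P [set w | (H w <= r)%R])) 1%R (o j))%:E.

Let mHle r : measurable [set w | (H w <= r)%R].
Proof.
rewrite [X in measurable X](_ : _ = setT `&` H @^-1` `]-oo, r]%classic).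
  exact: mH.
by rewrite setTI; apply/seteqP; split => w /=; rewrite in_itv.
Qed.

Let mH_le j r : measurable [set w | (H_ j w <= r)%R].
Proof.
rewrite [X in measurable X](_ : _ = setT `&` H_ j @^-1` `]-oo, r]%classic).
  exact: mH_.
by rewrite setTI; apply/seteqP; split => w /=; rewrite in_itv.
Qed.

Let mQ j : measurable_fun setT (Q j). Proof. by case: PQ. Qed.

Let lt_indic r w :
  ((r < H w)%R%:R : R) = \1_(~` [set w | (H w <= r)%R]) w.
Proof.
rewrite indicE; have [Hr|rH] := leP (H w) r; first by rewrite memNset//=; apply.
by rewrite mem_set//= => Hr; move: rH; rewrite ltNge Hr.
Qed.

Section grid.
Variables (e : R) (e0 : (0 < e)%R) (N : nat).

Let A (i : 'I_N) := [set q : R | i.+1%:R * e < expR (- q) <= i.+2%:R * e]%R.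
Let U (j : nat) (i : 'I_N) := [set w | H_ j w <= i.+2%:R * e]%R.
Let f (i : 'I_N) := fine (P [set w | (H w <= i.+2%:R * e)%R]).

Let mA i : measurable (A i).
Proof.
have mE : measurable_fun setT (fun q : R => expR (- q)).
  by apply: continuous_measurable_fun => x; apply: continuous_comp;
    [exact: opp_continuous|exact: continuous_expR].
rewrite [X in measurable X](_ : _ = setT `&` (fun q : R => expR (- q)) @^-1`
    `](i.+1%:R * e)%R, (i.+2%:R * e)%R]%classic).
  exact: mE.
by rewrite setTI; apply/seteqP; split => w /=; rewrite in_itv.
Qed.

Let tA : trivIset setT A.
Proof.
have lt_dis (i k : 'I_N) (q : R) : (i < k)%N -> A i q -> A k q -> False.
  move=> ik /= /andP[_ qi] /andP[kq _].
  have : (k.+1%:R * e < i.+2%:R * e)%R by exact: lt_le_trans qi.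
  by rewrite ltr_pM2r// ltr_nat ltnS ltnNge ik.
move=> i k _ _ [q [Ai Ak]]; apply/val_inj.
by case: (ltngtP i k) => // ik; exfalso; [exact: (lt_dis i k q)|exact: (lt_dis k i q)].
Qed.

Let f01 i : (0 <= f i <= 1)%R.
Proof.
rewrite /f fine_ge0//= -lee_fin fineK ?probability_le1//.
by apply: fin_num_measure.
Qed.

Let lamE i : intensity (A i) = e%:E.
Proof.
rewrite intensity_level ?mulr_gt0 ?ltr_pM2r ?ltr_nat//; congr EFin.
by rewrite -mulrBl -natrB// subSnn mul1r.
Qed.

(** Rounding e^{-Q_j} up to the grid of mesh [e] makes the level constant on each
    cell. All cells have intensity [e], so the exponent is the expectation of a
    Riemann sum. *)
Lemma prob_grid :
  P' [set w | forall j i, A i (Q j w) -> U j i w] =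
  (expR (- fine (\int[P]_w (staircase e N (H w))%:E)))%:E.
Proof.
rewrite (@prob_marks _ _ _ P' Q PQ N A (fun=> e) mA tA lamE U f)//; last 2 first.
- by move=> j i; exact: mH_le.
- move=> J s.
  pose o (j : 'I_J) := omap (fun i : 'I_N => (i.+2%:R * e)%R) (s j).
  have DQ : sigma_generated Q [set w | forall j : 'I_J, cell_of A (Q j w) = s j].
    apply: (sigma_generated_all (B := fun j => [set q | cell_of A q = s j])) => j.
    exact: measurable_cell.
  rewrite (_ : (\prod_(j < J) _)%R =
      (\prod_(j < J) oapp (fun r => fine (P [set w | (H w <= r)%R])) 1%R (o j))%R); last first.
    by apply: eq_bigr => j _; rewrite /o; case: (s j).
  rewrite -(indep_marks DQ); last first.
    by move=> j r; rewrite /o; case: (s j) => //= i [<-]; rewrite mulr_gt0.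
  congr (P' _); apply/seteqP; split => w /=.
    move=> h; split; first by move=> j; case: (h j).
    move=> j r; rewrite /o; case sj : (s j) => [i|]//= [<-].
    by have [_ /(_ i sj)] := h j.
  move=> [h1 h2] j; split; first exact: h1.
  by move=> i sji; apply: (h2 j); rewrite /o sji.
congr (expR (- _))%:E.
have mS (i : 'I_N) : measurable_fun setT (fun w => (e * (i.+2%:R * e < H w)%R%:R)%:E : \bar R).
  apply/measurable_EFinP; apply: measurable_funM => //.
  rewrite (_ : (fun w => _) = (\1_(~` [set w | (H w <= i.+2%:R * e)%R]) : O -> R)).
    by apply: measurable_indic; exact: measurableC.
  by apply/funext => w; rewrite lt_indic.
transitivity (fine (\sum_(i < N) \int[P]_w (e * (i.+2%:R * e < H w)%R%:R)%:E)).
  have fE (i : 'I_N) : \int[P]_w (e * (i.+2%:R * e < H w)%R%:R)%:E = (e * (1 - f i))%:E.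
    rewrite (_ : (fun w => _) =
      (fun w => e%:E * (\1_(~` [set w | (H w <= i.+2%:R * e)%R]) w)%:E)); last first.
      by apply/funext => w; rewrite -EFinM lt_indic.
    rewrite ge0_integralZl//; last 2 first.
    - by apply/measurable_EFinP; apply: measurable_indic; exact: measurableC.
    - by rewrite lee_fin ltW.
    rewrite integral_indic//; last exact: measurableC.
    rewrite setIT [X in _ * X](probability_setC P (mHle _)) EFinM EFinB fineK//.
    exact: fin_num_measure.
  by rewrite (eq_bigr _ (fun i _ => fE i)) sumEFin.
rewrite -ge0_integral_sum//.
- by congr fine; apply: eq_integral => w _; rewrite sumEFin.
- by move=> i w _; rewrite lee_fin mulr_ge0// ltW.
Qed.

Lemma measurable_grid : measurable [set w | forall j i, A i (Q j w) -> U j i w].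
Proof.
rewrite [X in measurable X](_ : _ = \bigcap_j
    \big[setI/setT]_(i < N) (~` (setT `&` Q j @^-1` A i) `|` U j i)).
  apply: bigcapT_measurable => j; apply: bigsetI_measurable => i _.
  by apply: measurableU; [apply: measurableC; exact: mQ|exact: mH_le].
apply/seteqP; split => w /=.
  move=> h j _; rewrite -bigcap_seq => i _ /=.
  have [AQ|AQ] := pselect (A i (Q j w)); first by right; exact: h.
  by left; case.
move=> h j i AQ; have /= := h j Logic.I.
rewrite -bigcap_seq => /(_ i (mem_index_enum _)) [] //.
by rewrite setTI => /(_ AQ).
Qed.

End grid.

Let G m := [set w | forall j (i : 'I_(4 ^ m)),
  (i.+1%:R * 2^-1 ^+ m < expR (- Q j w) <= i.+2%:R * 2^-1 ^+ m)%R ->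
  (H_ j w <= i.+2%:R * 2^-1 ^+ m)%R].

Let half_gt0 m : (0 < 2^-1 ^+ m :> R)%R.
Proof. by rewrite exprn_gt0// invr_gt0. Qed.

(** A dyadic cell splits into two cells at the next generation, whose right ends
    do not exceed its own, and the range covered grows; so the constraints become
    more demanding. *)
Let G_nonincreasing : nonincreasing_seq G.
Proof.
apply/nonincreasing_seqP => m; apply/subsetPset => w /= h j i /andP[xl xu].
set x := expR (- Q j w) in xl xu.
have dE : (2^-1 ^+ m = 2 * 2^-1 ^+ m.+1 :> R)%R by rewrite exprS mulrA mulfV ?mul1r.
have d0 := half_gt0 m.+1; set e := (2^-1 ^+ m.+1)%R in dE d0 *.
rewrite dE in xl xu.
have im : (i < 4 ^ m)%N by [].
have mid : (x <= i.*2.+3%:R * e)%R \/ (i.*2.+3%:R * e < x)%R.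
  by case: (leP x (i.*2.+3%:R * e)%R); [left|right].
have cast1 : (i.+1%:R * (2 * e) = i.*2.+2%:R * e)%R by rewrite -doubleS -muln2 natrM mulrA.
have cast2 : (i.+2%:R * (2 * e) = i.*2.+4%:R * e)%R by rewrite -!doubleS -muln2 natrM mulrA.
have cast3 : (i.*2.+3%:R * e <= i.*2.+4%:R * e)%R by rewrite ler_pM2r// ler_nat.
rewrite cast1 in xl; rewrite cast2 in xu.
case: mid => mid.
  have lt1 : (i.*2.+1 < 4 ^ m.+1)%N by rewrite expnS; lia.
  have /= := h j (Ordinal lt1); rewrite -/x.
  by rewrite xl mid => /(_ isT) /le_trans; apply; rewrite dE cast2.
have lt1 : (i.*2.+2 < 4 ^ m.+1)%N by rewrite expnS; lia.
have /= := h j (Ordinal lt1); rewrite -/x.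
by rewrite mid xu dE cast2; apply.
Qed.

(** Rounding up is harmless in the limit: a mark exceeding x = e^{-Q_j} also
    exceeds x rounded up to a fine enough grid. *)
Let bigcap_G : \bigcap_m G m = [set w | forall j, (H_ j w <= expR (- Q j w))%R].
Proof.
apply/seteqP; split => w /=; last first.
  by move=> h m _ j i /andP[_]; exact: le_trans.
move=> h j; rewrite leNgt; apply/negP => xH.
set x := expR (- Q j w) in xH *; have x0 : (0 < x)%R by exact: expR_gt0.
have : \forall m \near \oo, [/\ (2^-1 ^+ m < H_ j w - x)%R, (2^-1 ^+ m < x)%R & (x <= (2 ^ m)%:R)%R].
  near=> m; split.
  - near: m; apply: (cvgr_lt _ (@cvg_half_expn R)); by rewrite subr_gt0.
  - near: m; exact: (cvgr_lt _ (@cvg_half_expn R)).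
  - rewrite (le_trans (ltW (archi_boundP (ltW x0))))// ler_nat.
    by rewrite (@leq_trans m)//; [near: m; exact: nbhs_infty_ge|exact/ltnW/ltn_expl].
case=> m _ /(_ m (leqnn _)) /= [e1 e2 xm].
have d0 := half_gt0 m; set e := (2^-1 ^+ m)%R in e1 e2 d0 *.
(* The cell of x ends at n * e, and n >= 2 because x exceeds the mesh e. *)
have [n [xn nx]] := nat_ceil (divr_ge0 (ltW x0) (ltW d0)).
have xe1 : (1 < x / e)%R by rewrite ltr_pdivlMr// mul1r.
have n2 : (2 <= n)%N by rewrite -(ltr_nat R); exact: lt_le_trans xn.
have n4 : (n - 2 < 4 ^ m)%N.
  suff : (n <= 4 ^ m)%N by lia.
  rewrite -ltnS -(ltr_nat R) -natr1 (lt_le_trans nx)// lerD2r ler_pdivrMr//.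
  by rewrite dyadic_range.
have := h m Logic.I j (Ordinal n4); rewrite -/x -/e /=.
have -> : (n - 2).+2 = n by lia.
have -> : (n - 2).+1 = n.-1 by lia.
rewrite ler_pdivrMr// in xn.
have nE : (n%:R = n.-1%:R + 1 :> R)%R by rewrite natr1 prednK//; lia.
have nx' : (n.-1%:R * e < x)%R by rewrite -ltr_pdivlMr//; lra.
rewrite nx' xn => /(_ isT) Hn.
have : (n%:R * e = n.-1%:R * e + e)%R by rewrite nE mulrDl mul1r.
lra.
Unshelve. all: by end_near. Qed.

(** The formula exp(- E H) for the probability that no point is strictly below its
    mark: the dyadic events decrease to this one and the exponents converge by
    dominated convergence, the staircase being bounded by H. *)
Lemma poisson_max :
  P' [set w | forall j, (H_ j w <= expR (- Q j w))%R] =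
  (expR (- fine (\int[P]_w (H w)%:E)))%:E.
Proof.
rewrite -bigcap_G.
have mG m : measurable (G m).
  exact: measurable_grid.
have PG : P' (G m) @[m --> \oo] --> P' (\bigcap_m G m).
  apply: nonincreasing_cvg_mu => //.
  - by rewrite -ge0_fin_numE//; exact: fin_num_measure.
  - exact: bigcapT_measurable.
rewrite -(cvg_lim _ PG)//; apply/cvg_lim => //.
under eq_fun do rewrite (prob_grid (half_gt0 _) (4 ^ _)).
apply: cvg_EFin; first exact: nearW.
apply: continuous_cvg; first exact: continuous_expR.
apply: cvgN; apply: fine_cvg; rewrite fineK; last exact: integrable_fin_num.
have [|||||_ _] := @dominated_convergence _ _ _ P setT measurableT
  (fun m w => (staircase (2^-1 ^+ m)%R (4 ^ m) (H w))%:E) (EFin \o H) (EFin \o H) => //.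
- move=> m; apply/measurable_EFinP; apply: measurable_sum => i.
  apply: measurable_funM => //; under eq_fun do rewrite lt_indic.
  by apply: measurable_indic; exact: measurableC.
- exact/measurable_EFinP.
- by apply: nearW => w _; apply: cvg_EFin; [exact: nearW|exact: cvg_staircase].
- apply: nearW => w m _ /=; rewrite lee_fin ger0_norm ?staircase_le//.
  by rewrite staircase_ge0// ltW.
Qed.

End poisson_max.

(** * Weighted maxima of exponentials *)

Section hmax.
Context (R : realType) (T : Type).
Implicit Types (l : seq (T * R)) (f : T -> \bar R).

Definition hmax l f : R :=
  \big[Num.max/0%R]_(p <- l) (fine (expeR (f p.1)) * expR (- p.2))%R.

Definition raise (c : R) l := [seq (p.1, p.2 + c)%R | p <- l].

Lemma hmax_nil f : hmax [::] f = 0%R.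
Proof. by rewrite /hmax big_nil. Qed.

Lemma hmax_cons p l f : hmax (p :: l) f =
  Num.max (fine (expeR (f p.1)) * expR (- p.2))%R (hmax l f).
Proof. by rewrite /hmax big_cons. Qed.

Lemma fine_expeR_ge0 (x : \bar R) : (0 <= fine (expeR x))%R.
Proof. by rewrite fine_ge0// expeR_ge0. Qed.

Lemma hmax_ge0 l f : (0 <= hmax l f)%R.
Proof.
elim: l => [|p l ih]; first by rewrite hmax_nil.
by rewrite hmax_cons le_max ih orbT.
Qed.

(** The event that a maximum is at most r > 0 is a lower orthant in the
    coordinates f(t); this keeps all events needed about [hmax] within reach of
    finite dimensional distributions. *)
Lemma level_le (x : \bar R) (u r : R) : x != +oo -> (0 < r)%R ->
  (fine (expeR x) * expR (- u) <= r)%R = (x <= (u + ln r)%:E).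
Proof.
move=> xy r0; case: x xy => [x|//|] _ /=; last by rewrite mul0r leNye ltW.
by rewrite -expRD -{1}(lnK r0) ler_expR lee_fin lerBlDl.
Qed.

Lemma hmax_le l f r : (forall t, f t != +oo) -> (0 < r)%R ->
  (hmax l f <= r)%R = below (raise (ln r) l) f.
Proof.
move=> fy r0; elim: l => [|p l ih]; first by rewrite hmax_nil ltW.
by rewrite hmax_cons ge_max ih/= level_le.
Qed.

Lemma raise0 l : raise 0%R l = l.
Proof. by rewrite /raise -[RHS]map_id; apply: eq_map => -[t x] /=; rewrite addr0. Qed.

End hmax.

Lemma measurable_expeR (R : realType) : measurable_fun setT (@expeR R).
Proof.
apply: (measurability _ (ErealGenOInfty.measurableE R)) => //.
move=> _ [_ [r ->] <-]; rewrite setTI.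
have [r0|r0] := ltP r 0%R.
  rewrite (_ : _ @^-1` _ = setT); first exact: measurableT.
  by apply/seteqP; split => x //= _; rewrite in_itv/= andbT (lt_le_trans _ (expeR_ge0 x)).
rewrite (_ : _ @^-1` _ = `]lne r%:E, +oo[%classic); first exact: emeasurable_itv.
have rE : expeR (lne r%:E) = r%:E by rewrite lneK// in_itv/= lee_fin r0 leey.
by apply/seteqP; split => x /=; rewrite !in_itv/= !andbT -{1}rE lte_expeR.
Qed.

Section hmax_process.
Context (R : realType) (T : Type) d (O : measurableType d) (P : probability O R).
Variables (X : T -> O -> \bar R) (mX : forall t, measurable_fun setT (X t)).

Lemma measurable_expeRT (t : T) : measurable_fun setT (fun w => expeR (X t w)).
Proof. exact: measurableT_comp (@measurable_expeR R) (mX t). Qed.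

Lemma measurable_level (t : T) : measurable_fun setT (fun w => fine (expeR (X t w))).
Proof. by apply: measurableT_comp => //; exact: measurable_expeRT. Qed.

Lemma measurable_hmax l : measurable_fun setT (fun w => hmax l (X^~ w)).
Proof.
elim: l => [|p l ih].
  by rewrite (_ : (fun w => _) = cst 0%R)//; apply/funext => w; rewrite hmax_nil.
under eq_fun do rewrite hmax_cons.
apply: measurable_maxr => //; apply: measurable_funM => //.
exact: measurable_level.
Qed.

Hypothesis Xy : forall t w, X t w != +oo.
Hypothesis EX : forall t, \int[P]_w expeR (X t w) = 1.

Lemma integrable_level t : P.-integrable setT (fun w => (fine (expeR (X t w)))%:E).
Proof.
apply/integrableP; split; first by apply/measurable_EFinP; exact: measurable_level.
rewrite (eq_integral (fun w => expeR (X t w))) ?EX ?ltry// => w _.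
rewrite gee0_abs ?lee_fin ?fine_expeR_ge0// fineK//.
by rewrite ge0_fin_numE ?expeR_ge0// lt_neqAle leey andbT expeR_eqy.
Qed.

Lemma integrable_hmax l : P.-integrable setT (fun w => (hmax l (X^~ w))%:E).
Proof.
elim: l => [|p l ih].
  rewrite (_ : (fun w => _) = (cst 0))//; first exact: integrable0.
  by apply/funext => w; rewrite hmax_nil.
have ip : P.-integrable setT (fun w => (fine (expeR (X p.1 w)) * expR (- p.2))%R%:E).
  under eq_fun do rewrite EFinM muleC.
  by apply: integrableZl => //; exact: integrable_level.
apply: le_integrable (integrableD measurableT ip ih) => //.
  by apply/measurable_EFinP; exact: measurable_hmax.
move=> w _ /=; have a0 : (0 <= fine (expeR (X p.1 w)) * expR (- p.2))%R.
  by rewrite mulr_ge0 ?fine_expeR_ge0 ?expR_ge0.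
have b0 := hmax_ge0 l (X^~ w).
rewrite lee_fin hmax_cons !ger0_norm ?addr_ge0 ?le_max ?a0//.
by rewrite ge_max lerDl lerDr a0 b0.
Qed.

End hmax_process.

(** * Finite dimensional distributions of the max-stable process *)

Section zeta_law.
Context (R : realType) (T : zmodType)
  d (O : measurableType d) (P : probability O R) (Z : T -> O -> \bar R)
  d' (O' : measurableType d') (P' : probability O' R)
  (Q : nat -> O' -> R) (Zi : nat -> T -> O' -> \bar R).
Hypothesis Z_process : process Z.
Hypothesis EZ : forall t, \int[P]_w expeR (Z t w) = 1.
Hypothesis QZi : max_stable_construction P Z P' Q Zi.

Let mZ t : measurable_fun setT (Z t). Proof. by have [] := Z_process t. Qed.
Let mZi j t : measurable_fun setT (Zi j t).
Proof. by case: QZi => _ /(_ j t)[]. Qed.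
Let Zy t w : Z t w != +oo. Proof. by have [] := Z_process t. Qed.
Let Ziy j t w : Zi j t w != +oo. Proof. by case: QZi => _ /(_ j t)[]. Qed.

(** Dividing Q_j + Z_j(t) <= x by the point turns the event on the supremum into
    one inequality per point, in the form treated by [poisson_max]. *)
Lemma below_zeta (l : seq (T * R)) w :
  below l (zeta Q Zi ^~ w) <-> forall j, (hmax l (Zi j ^~ w) <= expR (- Q j w))%R.
Proof.
have zetaE t x : (zeta Q Zi t w <= x%:E) <-> forall j, Zi j t w <= (x - Q j w)%:E.
  split=> [tx j|tx].
    have : (Q j w)%:E + Zi j t w <= x%:E.
      by apply: le_trans tx; apply: ereal_sup_ubound; exists j.
    by rewrite EFinB leeBrDl.
  apply: ge_ereal_sup => _ [j _ <-].
  by have := tx j; rewrite EFinB leeBrDl.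
have hE j : (hmax l (Zi j ^~ w) <= expR (- Q j w))%R =
    below (raise (- Q j w) l) (Zi j ^~ w).
  by rewrite hmax_le ?expR_gt0// expRK.
split=> [lz j|lz].
  rewrite hE /below all_map; apply: sub_all lz => p /= /zetaE; exact.
have {}lz j : below (raise (- Q j w) l) (Zi j ^~ w) by rewrite -hE.
elim: l lz {hE} => //= p l ih h; apply/andP; split.
  by apply/zetaE => j; have /andP[] := h j.
by apply: ih => j; have /andP[] := h j.
Qed.

(** Independence of the points from the copies gives the first factor, and
    independence of the copies among themselves factorizes the second. *)
Lemma indep_hmax l J (D : set O') (o : 'I_J -> option R) :
  sigma_generated Q D -> (forall j r, o j = Some r -> (0 < r)%R) ->
  P' (D `&` [set w | forall (j : 'I_J) r, o j = Some r -> (hmax l (Zi j ^~ w) <= r)%R]) =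
  P' D * (\prod_(j < J) oapp (fun r => fine (P [set w | (hmax l (Z ^~ w) <= r)%R])) 1%R (o j))%:E.
Proof.
case: QZi => _ _ copies iid indep sD o0.
pose F n := [set w | forall (j : 'I_J) r, j = n :> nat -> o j = Some r ->
  (hmax l (Zi n ^~ w) <= r)%R].
have FE (j : 'I_J) : F j = if o j is Some r then
    [set w | below (raise (ln r) l) (Zi j ^~ w)] else setT.
  case oj : (o j) => [r|]; apply/seteqP; split => w //=.
  - by move=> /(_ j r erefl oj); rewrite hmax_le// (o0 _ _ oj).
  - move=> h k s /val_inj -> ; rewrite oj => -[<-].
    by rewrite hmax_le// (o0 _ _ oj).
  - by move=> _ k s /val_inj ->; rewrite oj.
have sF (j : 'I_J) : sigma_generated (Zi j) (F j).
  rewrite FE; case: (o j) => [r|]; first exact: sigma_generated_below.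
  exact: (@measurableT _ (g_sigma_algebraType _)).
have sF' (j : 'I_J) : sigma_generated (fun it : nat * T => Zi it.1 it.2) (F j).
  move: (F j) (sF j); apply: smallest_sub; first exact: smallest_sigma_algebra.
  move=> _ [t _ [B mB <-]]; apply: sub_sigma_algebra.
  by exists (val j, t) => //; exists B.
rewrite [X in D `&` X](_ : _ = \big[setI/setT]_(j < J) F j); last first.
  rewrite -bigcap_seq; apply/seteqP; split => w /= h.
    by move=> j _ k s kj; rewrite -kj; exact: h.
  by move=> j r; apply: (h j (mem_index_enum _)).
rewrite indep//; last first.
  apply: (@bigsetI_measurable _ (g_sigma_algebraType
    (\bigcup_it preimage_set_system setT ((fun it : nat * T => Zi it.1 it.2) it) measurable))) => j _.
  exact: sF'.
congr (_ * _).
have := iid (iota 0 J) F (iota_uniq 0 J).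
rewrite -bigcap_seq.
rewrite (_ : \bigcap_(i in _) _ = \big[setI/setT]_(j < J) F j); last first.
  rewrite -bigcap_seq; apply/seteqP; split => w /= h.
    by move=> j _; apply: h; rewrite /= mem_iota/= add0n.
  move=> n; rewrite /= mem_iota/= add0n => nJ.
  exact: (h (Ordinal nJ) (mem_index_enum _)).
rewrite bigcap_seq => ->; last first.
  by move=> n; rewrite mem_iota/= add0n => nJ; exact: (sF (Ordinal nJ)).
rewrite -[X in iota 0 X]subn0 -/(index_iota 0 J) big_mkord; congr EFin.
apply: eq_bigr => j _; rewrite FE; case oj : (o j) => [r|]/=; last first.
  by rewrite probability_setT.
rewrite (fdd_eq_below (copies j)); congr (fine (P _)).
by apply: eq_set => w; rewrite hmax_le// (o0 _ _ oj).
Qed.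

Lemma prob_below_zeta (l : seq (T * R)) :
  P' [set w | below l (zeta Q Zi ^~ w)] =
  (expR (- fine (\int[P]_w (hmax l (Z ^~ w))%:E)))%:E.
Proof.
rewrite (_ : [set _ | _] = [set w | forall j, (hmax l (Zi j ^~ w) <= expR (- Q j w))%R]); last first.
  by apply/seteqP; split => w /below_zeta.
apply: poisson_max => //.
- by case: QZi.
- exact: measurable_hmax.
- by move=> w; exact: hmax_ge0.
- exact: integrable_hmax.
- by move=> j; exact: measurable_hmax.
- exact: indep_hmax.
Qed.

Lemma measurable_zeta t : measurable_fun setT (zeta Q Zi t).
Proof.
have mQ j : measurable_fun setT (Q j) by case: QZi => -[].
rewrite (_ : zeta Q Zi t = fun w => esups (fun j => (Q j w)%:E + Zi j t w) 0%N).
  apply: measurable_fun_esups => j; apply: emeasurable_funD => //.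
  exact/measurable_EFinP.
apply/funext => w; rewrite /zeta /esups/= /sdrop; congr ereal_sup.
by apply/seteqP; split => _ [j _ <-]; exists j.
Qed.

Lemma stationary_zetaP : stationary P' (zeta Q Zi) <->
  forall h (l : seq (T * R)), \int[P]_w (hmax l (Z ^~ w))%:E =
    \int[P]_w (hmax l (lag h (Z ^~ w)))%:E.
Proof.
have lagE h (l : seq (T * R)) (f : T -> \bar R) :
    below l (lag h f) = below [seq ((p.1 - h)%R, p.2) | p <- l] f.
  by rewrite (below_map (fun t => (t - h)%R)).
have hlagE h (l : seq (T * R)) (f : T -> \bar R) :
    hmax l (lag h f) = hmax [seq ((p.1 - h)%R, p.2) | p <- l] f.
  by rewrite /hmax big_map.
have probE h (l : seq (T * R)) : P' [set w | below l (lag h (zeta Q Zi) ^~ w)] =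
    (expR (- fine (\int[P]_w (hmax l (lag h (Z ^~ w)))%:E)))%:E.
  under eq_integral do rewrite hlagE.
  rewrite -prob_below_zeta; congr (P' _); apply: eq_set => w.
  by rewrite -lagE.
have fin h l : \int[P]_w (hmax l (lag h (Z ^~ w)))%:E \is a fin_num.
  under eq_integral do rewrite hlagE.
  by apply: integrable_fin_num => //; exact: integrable_hmax.
have fin0 l : \int[P]_w (hmax l (Z ^~ w))%:E \is a fin_num.
  by apply: integrable_fin_num => //; exact: integrable_hmax.
split=> [st h l|st h].
  have := fdd_eq_below (st h) l; rewrite probE prob_below_zeta => -[/expR_inj/oppr_inj].
  by move=> e; rewrite -(fineK (fin h l)) -e fineK.
apply: below_fdd_eq => [t|t|l].
- exact: measurable_zeta.
- exact: measurable_zeta.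
- by rewrite probE prob_below_zeta (st h).
Qed.

End zeta_law.

(** * Paths and their tilted laws *)

Section paths.
Context (R : realType) (T : zmodType).
Implicit Types (f : T -> \bar R) (g : Fminf R T).

Lemma Ffun_inj : injective (@Ffun R T).
Proof.
move=> [f1 y1 n1] [f2 y2 n2] /= f12; case: _ / f12 in y2 n2 *.
by rewrite (Prop_irrelevance y1 y2) (Prop_irrelevance n1 n2).
Qed.

(** A path of Z may be identically -oo, and this event need not be measurable when
    the time set is uncountable. The dummy value is therefore used on the
    measurable event f(a) = -oo, where the weight e^{f(a)} vanishes. *)
Definition path_at (a : T) f : Fminf R T :=
  if pselect (exists g, Ffun g = f /\ f a != -oo) is left e then projT1 (cid e) else point.

Lemma path_atE a f : (forall t, f t != +oo) -> f a != -oo -> Ffun (path_at a f) = f.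
Proof.
move=> fy fa; rewrite /path_at; case: pselect => [e|]; first by case: cid => g [].
by case; exists (MkFminf fy (ex_intro _ a fa)).
Qed.

Lemma path_at_Ny a f : f a = -oo -> path_at a f = point.
Proof. by move=> fa; rewrite /path_at; case: pselect => // -[g []]; rewrite fa eqxx. Qed.

Lemma Fext_Ffun (Gam : Fminf R T -> R) g : Fext Gam (Ffun g) = Gam g.
Proof.
rewrite /Fext; case: pselect => [e|]; last by case; exists g.
by case: cid => g' /= /Ffun_inj ->.
Qed.

Lemma measurable_Feval (t : T) : measurable_fun setT (fun g : Fminf R T => g t).
Proof. exact: (measurable_eval (measurable_FminfE R T) t). Qed.

Lemma measurable_Fminf d (O : measurableType d) (X : O -> Fminf R T) :
  (forall t, measurable_fun setT (fun w => X w t)) -> measurable_fun setT X.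
Proof. exact: (measurable_fun_evals (measurable_FminfE R T)). Qed.

End paths.

Section theta_expectation.
Context (R : realType) (T : zmodType)
  d (O : measurableType d) (P : probability O R) (Z : T -> O -> \bar R)
  (a : T) d1 (O1 : measurableType d1) (PV : probability O1 R) (V : O1 -> Fminf R T)
  d2 (O2 : measurableType d2) (PW : probability O2 R) (W : O2 -> Fminf R T).
Hypothesis Z_process : process Z.
Hypothesis EZ : \int[P]_w expeR (Z a w) = 1.
Hypothesis V_law : conditional_law P Z a PV V.
Hypothesis W_law : tilted_law a PV V PW W.

Let mZ t : measurable_fun setT (Z t). Proof. by have [] := Z_process t. Qed.
Let Zy t w : Z t w != +oo. Proof. by have [] := Z_process t. Qed.

Let B := [set w | Z a w != -oo].

Let mB : measurable B.
Proof. by rewrite /B -[X in measurable X]setTI; exact: emeasurable_neq. Qed.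

Let Zpath w := path_at a (Z ^~ w).

Lemma measurable_path_at : measurable_fun setT Zpath.
Proof.
apply: measurable_Fminf => t.
rewrite (_ : (fun w => _) = fun w => if Z a w == -oo then (point : Fminf R T) t else Z t w).
  apply: measurable_fun_ifT => //.
  apply: (measurable_fun_bool true).
  rewrite (_ : _ @^-1` _ = ~` B); first by rewrite setTI; exact: measurableC.
  by apply/seteqP; split => w /=; rewrite /B/=; case: eqP.
apply/funext => w; case: ifPn => [/eqP Zw|Zw]; first by rewrite /Zpath path_at_Ny.
by rewrite /Zpath path_atE.
Qed.

Let p := fine (P B).

Let PBE : P B = p%:E. Proof. by rewrite fineK//; exact: fin_num_measure. Qed.

Let p_gt0 : (0 < p)%R.
Proof.
rewrite -lte_fin -PBE lt0e measure_ge0 andbT; apply/eqP => PB0.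
(* If Z(a) = -oo almost surely, then e^{Z(a)} has expectation 0 instead of 1. *)
have : \int[P]_w expeR (Z a w) = 0.
  rewrite -(integral0 P setT); apply: ae_eq_integral => //.
    exact: measurable_expeRT.
  exists B; split => //; move=> w /= h; rewrite /B/=; apply/eqP => Zw.
  by apply: h => _; rewrite Zw.
by rewrite EZ => /eqP; rewrite onee_eq0.
Qed.

Let V_expectation (g : Fminf R T -> \bar R) : measurable_fun setT g ->
  (forall x, 0 <= g x) ->
  \int[PV]_w g (V w) = \int[P]_w ((p^-1 * \1_B w)%:E * g (Zpath w)).
Proof.
case: V_law => mV VE mg g0.
pose Y : {mfun O1 >-> Fminf R T} := HB.pack V (isMeasurableFun.Build _ _ _ _ _ mV).
rewrite -(@ge0_integral_distribution _ _ _ _ _ PV Y)//.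
apply: weighted_law_integral => //.
- exact: measurable_path_at.
- by apply/measurable_EFinP; apply: measurable_funM => //; exact: measurable_indic.
- by move=> w; rewrite lee_fin mulr_ge0// invr_ge0 ltW.
move=> A mA; rewrite -[LHS]/(PV (V @^-1` A)) VE//.
rewrite (_ : [set w | _] = B `&` Zpath @^-1` A); last first.
  apply/seteqP; split => w /= [Zw].
    move=> [g1 Ag1 g1E]; split => //.
    by rewrite (_ : Zpath w = g1)//; apply: Ffun_inj; rewrite path_atE.
  by move=> AZ; split => //; exists (Zpath w) => //; rewrite path_atE.
have mZA : measurable (Zpath @^-1` A).
  by rewrite -[X in measurable X]setTI; exact: measurable_path_at.
rewrite PBE muleC inver gt_eqF//.
under eq_integral do rewrite -EFinM -mulrA EFinM.
rewrite ge0_integralZl//; last 2 first.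
- apply/measurable_EFinP; apply: measurable_funM; exact: measurable_indic.
- by rewrite lee_fin invr_ge0 ltW.
congr (_ * _); rewrite -[LHS]/(P _) -[X in P X]setIT -integral_indic//; last exact: measurableI.
by apply: eq_integral => w _; rewrite indicI.
Qed.

Let pB_expeR w : ((p^-1 * \1_B w)%:E * expeR (Zpath w a) = p^-1%:E * expeR (Z a w)).
Proof.
have [Zw|Zw] := eqVneq (Z a w) -oo.
  by rewrite Zw mule0 indicE memNset ?mulr0 ?mul0e//= /B/= Zw eqxx.
by rewrite path_atE// indicE mem_set// mulr1.
Qed.

(** Conditioning on Z(a) > -oo divides by p = P(Z(a) > -oo), which makes
    E e^{V(a)} equal to 1/p, and the normalization of the tilting multiplies by p
    again: the two effects cancel. *)
Lemma theta_expectation (g : Fminf R T -> \bar R) : measurable_fun setT g ->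
  (forall x, 0 <= g x) ->
  \int[PW]_w g (W w) = \int[P]_w (expeR (Z a w) * g (Zpath w)).
Proof.
move=> mg g0; case: (V_law) => mV _; case: W_law => mW WE.
have meval : measurable_fun setT (fun x : Fminf R T => expeR (x a)).
  exact: measurableT_comp (@measurable_expeR R) (measurable_Feval (R := R) a).
have EV : \int[PV]_w expeR (V w a) = p^-1%:E.
  rewrite (V_expectation meval)//; last by move=> x; exact: expeR_ge0.
  under eq_integral do rewrite pB_expeR.
  rewrite ge0_integralZl//; first by rewrite EZ mule1.
  - exact: measurable_expeRT.
  - by move=> w _; exact: expeR_ge0.
  - by rewrite lee_fin invr_ge0 ltW.
have wE x : x != +oo -> expeR (x - lne (\int[PV]_w expeR (V w a))) = p%:E * expeR x.
  move=> xy; rewrite EV lne_EFin ?invr_gt0// lnV// -EFinN opprK.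
  case: x xy => [x|//|] _ /=; last by rewrite mule0.
  by rewrite expRD lnK// mulrC.
have {}WE A : measurable A -> PW (W @^-1` A) =
    \int[PV]_w (p%:E * expeR (V w a) * (\1_(V @^-1` A) w)%:E).
  move=> mA; rewrite WE//; apply: eq_integral => w _; rewrite wE//.
  exact: Ffun_neqy.
pose Y : {mfun O2 >-> Fminf R T} := HB.pack W (isMeasurableFun.Build _ _ _ _ _ mW).
rewrite -(@ge0_integral_distribution _ _ _ _ _ PW Y)//.
rewrite (@weighted_law_integral _ _ _ _ _ PV (distribution PW Y) V
  (fun w => p%:E * expeR (V w a)))//; last 3 first.
- by apply: emeasurable_funM => //; exact: measurableT_comp meval mV.
- by move=> w; rewrite mule_ge0 ?expeR_ge0// lee_fin ltW.
- move=> w; rewrite fin_numM// ge0_fin_numE ?expeR_ge0// lt_neqAle leey andbT.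
  by rewrite expeR_eqy Ffun_neqy.
rewrite (V_expectation (g := fun x => p%:E * expeR (x a) * g x)); last 2 first.
- by apply: emeasurable_funM => //; exact: emeasurable_funM.
- by move=> x; rewrite !mule_ge0 ?expeR_ge0// lee_fin ltW.
apply: eq_integral => w _.
rewrite [in LHS]muleA [X in X * _](_ : _ = expeR (Z a w))//.
rewrite [X in _ * X]muleC muleA pB_expeR muleAC -EFinM mulVf ?mul1e//.
by rewrite gt_eqF.
Qed.

End theta_expectation.

Section recenter.
Context (R : realType) (T : zmodType).

Definition recenter (s : T) (f : Fminf R T) : Fminf R T := Fadd f (- fine (f s))%R.

Lemma lagF_neqy (h : T) (f : Fminf R T) t : lag h f t != +oo.
Proof. exact: Ffun_neqy. Qed.

Lemma lagF_nontrivial (h : T) (f : Fminf R T) : exists t, lag h f t != -oo.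
Proof. by have [t ft] := Ffun_nontrivial f; exists (t + h)%R; rewrite /lag addrK. Qed.

Definition lagF (h : T) (f : Fminf R T) : Fminf R T :=
  MkFminf (lagF_neqy h f) (lagF_nontrivial h f).

Lemma measurable_recenter s : measurable_fun setT (recenter s).
Proof.
apply: measurable_Fminf => t; apply: emeasurable_funD; first exact: measurable_Feval.
apply/measurable_EFinP; apply: measurableT_comp => //.
by apply: measurableT_comp (measurable_Feval s) => //; exact: fine_measurable.
Qed.

Lemma measurable_lagF h : measurable_fun setT (lagF h).
Proof. by apply: measurable_Fminf => t; exact: measurable_Feval. Qed.

Lemma lagF_path a h (f : T -> \bar R) : (forall t, f t != +oo) -> f a != -oo ->
  lagF h (path_at a f) = path_at (a + h)%R (lag h f).
Proof.
move=> fy fa; apply: Ffun_inj; rewrite path_atE.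
- by rewrite /= path_atE.
- by move=> t; exact: fy.
- by rewrite /lag addrK.
Qed.

(** Away from f(s) = -oo the recentred path is f - f(s), the path of Theta when f
    is a path of the tilted process. *)
Lemma recenterE s (f : Fminf R T) : f s != -oo ->
  Ffun (recenter s f) = fun t => f t - f s.
Proof.
move=> fs; apply/funext => t /=; have := Ffun_neqy f s.
by case: (f s) fs.
Qed.

End recenter.

(** * Maxima determine tilted laws, and conversely *)

Section excess.
Context (R : realType) (T : Type) d (O : measurableType d) (P : probability O R).

Definition top_mass (X : T -> O -> \bar R) s l : \bar R :=
  \int[P]_w (fine (expeR (X s w)) * (hmax l (X ^~ w) <= fine (expeR (X s w)))%R%:R)%:E.

(** The right derivative at c = 1 of c |-> max(c a, b). *)
Let cvg_slope (a b : R) : (0 <= a)%R ->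
  (n.+1%:R * (Num.max ((1 + n.+1%:R^-1) * a) b - Num.max a b))%R @[n --> \oo] -->
  (a * (b <= a)%R%:R)%R.
Proof.
move=> a0; have [ba|ab] := leP b a.
  apply: cvg_near_cst; apply: nearW => n.
  have n0 : (0 < n.+1%:R :> R)%R by rewrite ltr0n.
  have ni : (0 < n.+1%:R^-1 :> R)%R by rewrite invr_gt0.
  rewrite !max_l//; first by rewrite mulrDl mul1r addrAC subrr add0r mulrA mulfV ?mul1r ?mulr1 ?gt_eqF.
  by rewrite (le_trans ba)// ler_peMl// lerDl ltW.
rewrite mulr0; apply: cvg_near_cst.
near=> n.
have n0 : (0 < n.+1%:R :> R)%R by rewrite ltr0n.
suff cb : ((1 + n.+1%:R^-1) * a <= b)%R.
  by rewrite (max_r cb) subrr mulr0.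
(* This holds as soon as n >= a / (b - a). *)
rewrite mulrDl mul1r -lerBrDl ler_pdivrMl//.
apply: (@le_trans _ _ (n%:R * (b - a))%R); last first.
  by rewrite ler_wpM2r ?subr_ge0 ?ler_nat// ltW.
rewrite -ler_pdivrMr ?subr_gt0//.
near: n; exact: nbhs_infty_ger.
Unshelve. all: by end_near. Qed.

Let slope_bounds (a b : R) n : (0 <= a)%R ->
  (0 <= n.+1%:R * (Num.max ((1 + n.+1%:R^-1) * a) b - Num.max a b) <= a)%R.
Proof.
move=> a0; have n0 : (0 < n.+1%:R :> R)%R by rewrite ltr0n.
have ni : (0 < n.+1%:R^-1 :> R)%R by rewrite invr_gt0.
have ea : (n.+1%:R * ((1 + n.+1%:R^-1) * a - a) = a)%R.
  by rewrite mulrDl mul1r addrAC subrr add0r mulrA mulfV ?mul1r ?gt_eqF.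
have la : (a <= (1 + n.+1%:R^-1) * a)%R by rewrite ler_peMl// lerDl ltW.
apply/andP; split.
  apply: mulr_ge0; first exact: ltW.
  by rewrite subr_ge0 ge_max !le_max la lexx orbT.
rewrite -[leRHS]ea ler_pM2l//.
set c := ((1 + _) * a)%R in la *.
have [ca|ac] := leP c b; last first.
  by rewrite lerD2l lerN2 le_max lexx.
by rewrite (max_r (le_trans la ca)) subrr subr_ge0.
Qed.

Let slope_cvg (X : T -> O -> \bar R) s l :
  (forall t, measurable_fun setT (X t)) -> (forall t w, X t w != +oo) ->
  (forall t, \int[P]_w expeR (X t w) = 1) ->
  n.+1%:R%:E * (\int[P]_w (hmax ((s, - ln (1 + n.+1%:R^-1))%R :: l) (X ^~ w))%:E -
    \int[P]_w (hmax ((s, 0%R) :: l) (X ^~ w))%:E) @[n --> \oo] --> top_mass X s l.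
Proof.
move=> mX Xy EX.
have hE n w : hmax ((s, - ln (1 + n.+1%:R^-1))%R :: l) (X ^~ w) =
    Num.max ((1 + n.+1%:R^-1) * fine (expeR (X s w)))%R (hmax l (X ^~ w)).
  have c0 : (1 + n.+1%:R^-1 : R)%R \is Num.pos by rewrite posrE addr_gt0// invr_gt0 ltr0n.
  by rewrite hmax_cons; congr (Num.max _ _); rewrite [(_, _).2]/= opprK (lnK c0) mulrC.
have hE0 w : hmax ((s, 0%R) :: l) (X ^~ w) = Num.max (fine (expeR (X s w))) (hmax l (X ^~ w)).
  by rewrite hmax_cons/= oppr0 expR0 mulr1.
have mlev : measurable_fun setT (fun w => fine (expeR (X s w))) by exact: measurable_level.
have mh l' : measurable_fun setT (fun w => hmax l' (X ^~ w)) by exact: measurable_hmax.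
have [|||||_ _] := @dominated_convergence _ _ _ P setT measurableT
  (fun n w => (n.+1%:R * (hmax ((s, - ln (1 + n.+1%:R^-1))%R :: l) (X ^~ w) -
     hmax ((s, 0%R) :: l) (X ^~ w)))%:E)
  (fun w => (fine (expeR (X s w)) * (hmax l (X ^~ w) <= fine (expeR (X s w)))%R%:R)%:E)
  (fun w => (fine (expeR (X s w)))%:E).
- by move=> n; apply/measurable_EFinP; apply: measurable_funM => //; exact: measurable_funB.
- apply/measurable_EFinP; apply: measurable_funM => //.
  apply: (measurableT_comp (f := fun b : bool => b%:R : R)) => //.
  exact: measurable_fun_ler.
- apply: nearW => w _; apply: cvg_EFin; first exact: nearW.
  under eq_fun do rewrite hE hE0; apply: cvg_slope.
  exact: fine_expeR_ge0.
- exact: integrable_level.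
- apply: nearW => w n _; rewrite hE hE0 /= lee_fin.
  have /andP[? ?] := slope_bounds (hmax l (X ^~ w)) n (fine_expeR_ge0 (X s w)).
  by rewrite ger0_norm.
apply: cvg_trans; apply: near_eq_cvg; apply: nearW => n /=.
under [LHS]eq_integral do rewrite EFinM EFinB.
have ih l' : P.-integrable setT (fun w => (hmax l' (X ^~ w))%:E) by exact: integrable_hmax.
by rewrite integralZl ?integralB//; exact: integrableB.
Qed.

(** Scaling e^{X(s)} by c = 1 + 1/(n+1) amounts to adding the pair
    (s, - ln c) to the list, so the difference quotients of the right derivative
    only involve expectations of maxima; they are bounded by e^{X(s)}, and
    dominated convergence applies. *)
Lemma eq_top_mass (X Y : T -> O -> \bar R) :
  (forall t, measurable_fun setT (X t)) -> (forall t w, X t w != +oo) ->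
  (forall t, \int[P]_w expeR (X t w) = 1) ->
  (forall t, measurable_fun setT (Y t)) -> (forall t w, Y t w != +oo) ->
  (forall t, \int[P]_w expeR (Y t w) = 1) ->
  (forall l, \int[P]_w (hmax l (X ^~ w))%:E = \int[P]_w (hmax l (Y ^~ w))%:E) ->
  forall s l, top_mass X s l = top_mass Y s l.
Proof.
move=> mX Xy EX mY Yy EY XY s l.
rewrite -(cvg_lim _ (@slope_cvg X s l mX Xy EX))// -(cvg_lim _ (@slope_cvg Y s l mY Yy EY))//.
by under eq_fun do rewrite !XY.
Qed.

End excess.

Section spectral.
Context (R : realType) (T : zmodType) d (O : measurableType d) (P : probability O R).
Implicit Types (Y : T -> O -> \bar R) (l : seq (T * R)).

(** E e^{Y(s)} g(Y - Y(s)), the expectation of g at the process Theta_s built from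
    Y. *)
Definition spectral Y s (g : Fminf R T -> \bar R) : \bar R :=
  \int[P]_w (expeR (Y s w) * g (recenter s (path_at s (Y ^~ w)))).

(** Strict inequalities serve to break ties between indices at which a maximum is
    attained. *)
Definition strictly_below l (f : T -> \bar R) : bool :=
  all (fun p => f p.1 < p.2%:E) l.

Lemma level_lt (x : \bar R) (u r : R) : x != +oo -> (0 < r)%R ->
  (fine (expeR x) * expR (- u) < r)%R = (x < (u + ln r)%:E).
Proof.
move=> xy r0; case: x xy => [x|//|] _ /=; last by rewrite mul0r r0 ltNyr.
by rewrite -expRD -{1}(lnK r0) ltr_expR lte_fin ltrBlDl.
Qed.

Lemma hmax_lt l (f : T -> \bar R) (r : R) : (forall t, f t != +oo) -> (0 < r)%R ->
  (hmax l f < r)%R = strictly_below (raise (ln r) l) f.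
Proof.
move=> fy r0; elim: l => [|p l ih]; first by rewrite hmax_nil r0.
by rewrite hmax_cons gt_max ih/= level_lt.
Qed.

Definition shape_set l1 l2 : set (Fminf R T) := [set f | below l1 f && strictly_below l2 f].

Lemma measurable_shape l1 l2 : measurable (shape_set l1 l2).
Proof.
rewrite (_ : shape_set l1 l2 = [set f | below l1 f] `&` [set f | strictly_below l2 f]).
  apply: measurableI; first exact: measurable_below (measurable_FminfE R T) l1.
  elim: l2 => [|p l ih].
    by rewrite [X in measurable X](_ : _ = setT)//; apply/seteqP; split.
  rewrite [X in measurable X](_ : _ = (setT `&` [set f | Ffun f p.1 < p.2%:E]) `&`
      [set f | strictly_below l f]).
    apply: measurableI => //; apply: emeasurable_fun_infty_o => //.
    exact: measurable_Feval.
  by apply/seteqP; split => y /= => [/andP[]|[[_ ? ?]]] //; apply/andP.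
by apply/seteqP; split => f /= /andP.
Qed.

Lemma raise_below (c y : R) l (f : T -> \bar R) :
  below (raise c l) (fun t => f t - y%:E) = below (raise (y + c)%R l) f.
Proof.
rewrite /below !all_map; apply: eq_all => p; rewrite /preim/=.
case: (f p.1) => [r| |].
- by rewrite -EFinB !lee_fin lerBlDr; congr (_ <= _)%R; ring.
- by rewrite addye// !leye_eq.
- by rewrite addNye !leNye.
Qed.

Lemma raise_strictly_below (c y : R) l (f : T -> \bar R) :
  strictly_below (raise c l) (fun t => f t - y%:E) = strictly_below (raise (y + c)%R l) f.
Proof.
rewrite /strictly_below !all_map; apply: eq_all => p; rewrite /preim/=.
case: (f p.1) => [r| |].
- by rewrite -EFinB !lte_fin ltrBlDr; congr (_ < _)%R; ring.
- by rewrite addye// !ltNge !leey.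
- by rewrite addNye !ltNyr.
Qed.

(** That e^{Y(s) - x} dominates other exponentials only depends on Y - Y(s). *)
Lemma spectral_shape Y s (x : R) l1 l2 : process Y ->
  \int[P]_w (fine (expeR (Y s w)) * expR (- x) *
    ((hmax l1 (Y ^~ w) <= fine (expeR (Y s w)) * expR (- x)) &&
     (hmax l2 (Y ^~ w) < fine (expeR (Y s w)) * expR (- x)))%R%:R)%:E =
  (expR (- x))%:E * spectral Y s (fun f => (\1_(shape_set (raise (- x)%R l1) (raise (- x)%R l2)) f)%:E).
Proof.
move=> pY; have Yy t w : Y t w != +oo by have [] := pY t.
have mY t : measurable_fun setT (Y t) by have [] := pY t.
rewrite /spectral -ge0_integralZl//.
- apply: eq_integral => w _.
  have [Yw|Yw] := eqVneq (Y s w) -oo; first by rewrite Yw/= !mul0r mul0e mule0.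
  have [y Yyw] : exists y, Y s w = y%:E.
    by have := Yy s w; case: (Y s w) Yw => // y _ _; exists y.
  rewrite hmax_le ?hmax_lt// ?Yyw ?mulr_gt0 ?expR_gt0//.
  rewrite indicE /shape_set.
  have -> : (recenter s (path_at s (Y ^~ w)) \in
     [set f | below (raise (- x)%R l1) (Ffun f) && strictly_below (raise (- x)%R l2) (Ffun f)]) =
     below (raise (y - x)%R l1) (Y ^~ w) && strictly_below (raise (y - x)%R l2) (Y ^~ w).
    have rE : Ffun (recenter s (path_at s (Y ^~ w))) = fun t => Y t w - y%:E.
      by rewrite recenterE path_atE// Yyw.
    rewrite -raise_below -raise_strictly_below -rE.
    by apply/idP/idP; rewrite inE.
  have lnE : ln (fine (expeR y%:E) * expR (- x)) = (y - x)%R.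
    by rewrite /= -expRD expRK.
  by rewrite lnE /= -!EFinM; congr EFin; rewrite mulrA [(expR (- x) * _)%R]mulrC.
- apply: emeasurable_funM; first exact: measurable_expeRT.
  apply/measurable_EFinP; apply: (measurableT_comp (f := \1_(shape_set _ _) : Fminf R T -> R)).
    by apply: measurable_indic; exact: measurable_shape.
  by apply: measurableT_comp (measurable_recenter s) (measurable_path_at s pY).
- by move=> w _; rewrite mule_ge0 ?expeR_ge0// lee_fin.
Qed.

End spectral.

Lemma process_lag (R : realType) (T : zmodType) d (O : measurableType d)
  (Y : T -> O -> \bar R) h : process Y -> process (lag h Y).
Proof. by move=> pY t; exact: pY. Qed.

(** Recovering E H_l from [spectral]. A direct sum over the first index attaining
    the maximum would need bookkeeping of the indices on either side; instead,
    [excess l' l] is H_l on the event that it strictly exceeds H_{l'}, and the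
    pairs move one by one from [l] to [l']. *)
Section eq_hmax.
Context (R : realType) (T : zmodType) d (O : measurableType d) (P : probability O R).
Variables (X Y : T -> O -> \bar R).
Hypotheses (pX : process X) (pY : process Y).
Hypothesis XY : forall s l1 l2,
  spectral P X s (fun f => (\1_(shape_set l1 l2) f)%:E) =
  spectral P Y s (fun f => (\1_(shape_set l1 l2) f)%:E).

Let excess (Z : T -> O -> \bar R) l' l w : R :=
  (hmax l (Z ^~ w) * (hmax l' (Z ^~ w) < hmax l (Z ^~ w))%R%:R)%R.

Let lead (Z : T -> O -> \bar R) p l l' w : R :=
  (fine (expeR (Z p.1 w)) * expR (- p.2) *
    ((hmax l (Z ^~ w) <= fine (expeR (Z p.1 w)) * expR (- p.2)) &&
     (hmax l' (Z ^~ w) < fine (expeR (Z p.1 w)) * expR (- p.2)))%R%:R)%R.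

(** Either the first pair attains the maximum and beats the pairs of [l'], which is
    [lead], or the maximum over [l] beats it, and it joins [l']. *)
Let excess_cons Z l' p l w :
  excess Z l' (p :: l) w = (lead Z p l l' w + excess Z (p :: l') l w)%R.
Proof.
rewrite /excess /lead !hmax_cons.
set e := (_ * expR _)%R; set h := hmax l _; set h' := hmax l' _.
have [he|eh] := leP h e.
  by rewrite gt_max [(e < h)%R]ltNge he/= mulr0 addr0.
by rewrite /= mulr0 add0r gt_max eh.
Qed.

Let measurable_excess Z l' l : process Z -> measurable_fun setT (excess Z l' l).
Proof.
move=> pZ; have mZ t : measurable_fun setT (Z t) by have [] := pZ t.
apply: measurable_funM; first exact: measurable_hmax.
apply: (measurableT_comp (f := fun b : bool => b%:R : R)) => //.
by apply: measurable_fun_ltr; exact: measurable_hmax.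
Qed.

Let measurable_lead Z p l l' : process Z -> measurable_fun setT (lead Z p l l').
Proof.
move=> pZ; have mZ t : measurable_fun setT (Z t) by have [] := pZ t.
have me : measurable_fun setT (fun w => fine (expeR (Z p.1 w)) * expR (- p.2))%R.
  by apply: measurable_funM => //; exact: measurable_level.
apply: measurable_funM => //.
apply: (measurableT_comp (f := fun b : bool => b%:R : R)) => //.
apply: measurable_and.
  by apply: measurable_fun_ler => //; exact: measurable_hmax.
by apply: measurable_fun_ltr => //; exact: measurable_hmax.
Qed.

Let integral_excess_cons Z l' p l : process Z ->
  \int[P]_w (excess Z l' (p :: l) w)%:E =
  \int[P]_w (lead Z p l l' w)%:E + \int[P]_w (excess Z (p :: l') l w)%:E.
Proof.
move=> pZ; under eq_integral do rewrite excess_cons EFinD.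
rewrite ge0_integralD//.
- move=> w _; rewrite lee_fin; apply: mulr_ge0 => //.
  by apply: mulr_ge0; [exact: fine_expeR_ge0|exact: expR_ge0].
- by apply/measurable_EFinP; exact: measurable_lead.
- by move=> w _; rewrite lee_fin mulr_ge0// hmax_ge0.
- by apply/measurable_EFinP; exact: measurable_excess.
Qed.

Let eq_excess l l' : \int[P]_w (excess X l' l w)%:E = \int[P]_w (excess Y l' l w)%:E.
Proof.
elim: l l' => [|p l ih] l'.
  have excess0 Z w : excess Z l' [::] w = 0%R by rewrite /excess hmax_nil mul0r.
  by apply: eq_integral => w _; rewrite !excess0.
by rewrite !integral_excess_cons// ih !spectral_shape// XY.
Qed.

Lemma eq_integral_hmax l :
  \int[P]_w (hmax l (X ^~ w))%:E = \int[P]_w (hmax l (Y ^~ w))%:E.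
Proof.
have excessE Z w : excess Z [::] l w = hmax l (Z ^~ w).
  rewrite /excess hmax_nil.
  have := hmax_ge0 l (Z ^~ w); rewrite le_eqVlt => /orP[/eqP <-|->].
    by rewrite mul0r.
  by rewrite mulr1.
by have := eq_excess l [::]; under eq_integral do rewrite excessE;
  under [RHS]eq_integral do rewrite excessE.
Qed.

End eq_hmax.

Section eq_spectral_law.
Context (R : realType) (T : zmodType) d (O : measurableType d) (P : probability O R).
Context d1 (O1 : measurableType d1) (P1 : probability O1 R) (E1 : O1 -> Fminf R T)
  d2 (O2 : measurableType d2) (P2 : probability O2 R) (E2 : O2 -> Fminf R T).

Lemma prob_below_top_mass (X : T -> O -> \bar R) s : process X ->
  measurable_fun setT E1 ->
  (forall g : Fminf R T -> \bar R, measurable_fun setT g -> (forall f, 0 <= g f) ->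
    \int[P1]_w g (E1 w) = spectral P X s g) ->
  forall l, P1 [set w | below l (E1 w)] = top_mass P X s l.
Proof.
move=> pX mE1 EE1 l.
(* With x = 0 and no strict inequality in the list, the second test only asks
   that e^{X(s)} be positive, and the integrand vanishes otherwise. *)
have := @spectral_shape _ _ _ _ P X s 0%R l [::] pX.
rewrite oppr0 expR0 mul1e raise0 /= -EE1; last 2 first.
- by apply/measurable_EFinP; apply: measurable_indic; exact: measurable_shape.
- by move=> f; rewrite lee_fin.
have -> : \int[P1]_w (\1_(shape_set l [::]) (E1 w))%:E = P1 [set w | below l (E1 w)].
  rewrite -[[set w | _]]setIT -integral_indic//; last first.
    rewrite -[X in measurable X]setTI.
    exact: mE1 (measurable_below (measurable_FminfE R T) l).
  apply: eq_integral => w _; rewrite !indicE /shape_set; congr ((nat_of_bool _)%:R%:E).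
  by apply/idP/idP; rewrite !inE/= andbT.
move=> <-; apply: eq_integral => w _; rewrite mulr1 hmax_nil; congr EFin.
have := fine_expeR_ge0 (X s w); rewrite le_eqVlt => /orP[/eqP <-|->].
  by rewrite !mul0r.
by rewrite andbT.
Qed.

End eq_spectral_law.

(** * The equivalence *)

Section theta_process.
Context (R : realType) (T : zmodType)
  d (O : measurableType d) (P : probability O R) (Z : T -> O -> \bar R)
  (a : T) d1 (O1 : measurableType d1) (PV : probability O1 R) (V : O1 -> Fminf R T)
  d2 (O2 : measurableType d2) (PW : probability O2 R) (W : O2 -> Fminf R T).
Hypothesis Z_process : process Z.
Hypothesis EZ : \int[P]_w expeR (Z a w) = 1.
Hypothesis V_law : conditional_law P Z a PV V.
Hypothesis W_law : tilted_law a PV V PW W.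

Let mW : measurable_fun setT W. Proof. by case: W_law. Qed.

Let W_null := [set w | W w a = -oo].

Let measurable_W_null : measurable W_null.
Proof.
rewrite (_ : W_null = setT `&` (fun w => W w a) @^-1` [set -oo]).
  by apply: measurableT_comp (measurable_Feval a) mW _ _ _.
by rewrite setTI.
Qed.

Lemma prob_W_null : PW W_null = 0.
Proof.
have mI : measurable_fun setT (fun f : Fminf R T => (\1_[set f : Fminf R T | f a = -oo%E] f)%:E : \bar R).
  apply/measurable_EFinP; apply: measurable_indic.
  rewrite [X in measurable X](_ : _ = setT `&` (fun f : Fminf R T => f a) @^-1` [set -oo%E]).
    exact: measurable_Feval.
  by rewrite setTI.
rewrite -[W_null]setIT -integral_indic//.
rewrite (_ : \int[PW]_w (\1_W_null w)%:E =
  \int[PW]_w (\1_[set f : Fminf R T | f a = -oo%E] (W w))%:E)//.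
rewrite (theta_expectation Z_process EZ V_law W_law mI); last first.
  by move=> f; rewrite lee_fin.
apply: integral0_eq => w _.
have [Zw|Zw] := eqVneq (Z a w) -oo; first by rewrite Zw mul0e.
rewrite indicE memNset ?mule0//= path_atE//; first exact/eqP.
by move=> t; have [] := Z_process t.
Qed.

(** Almost surely this is L^h Theta_a, but with paths in [Fminf] everywhere, so
    that laws on the path space can be compared; the recentring is at the time
    a + h to which the lag moves a. *)
Definition shifted_shape h w : Fminf R T := recenter (a + h)%R (lagF h (W w)).

Lemma measurable_shifted_shape h : measurable_fun setT (shifted_shape h).
Proof.
exact: measurableT_comp (@measurable_recenter R T (a + h)%R)
  (measurableT_comp (measurable_lagF h) mW).
Qed.

Lemma shifted_shape_expectation h (g : Fminf R T -> \bar R) : measurable_fun setT g ->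
  (forall f, 0 <= g f) ->
  \int[PW]_w g (shifted_shape h w) = spectral P (lag h Z) (a + h)%R g.
Proof.
move=> mg g0.
have mgr : measurable_fun setT (fun f : Fminf R T => g (recenter (a + h)%R (lagF h f))).
  apply: measurableT_comp mg _.
  exact: measurableT_comp (@measurable_recenter R T (a + h)%R) (measurable_lagF h).
rewrite (theta_expectation Z_process EZ V_law W_law mgr)//.
apply: eq_integral => w _; rewrite /lag addrK.
have [Zw|Zw] := eqVneq (Z a w) -oo; first by rewrite Zw !mul0e.
by rewrite lagF_path// => t; have [] := Z_process t.
Qed.

Lemma shifted_shape_theta h w : W w a != -oo ->
  Ffun (shifted_shape h w) = lag h (fun t => Theta W a t w).
Proof.
by move=> Wa; rewrite recenterE /= /lag addrK.
Qed.

Lemma measurable_theta t : measurable_fun setT (Theta W a t).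
Proof.
by apply: emeasurable_funB; apply: measurableT_comp (measurable_Feval _) mW.
Qed.

Lemma prob_tuple_theta h n (t : n.-tuple T) (B : set (n.-tuple (\bar R))) : measurable B ->
  PW [set w | B [tuple lag h (Theta W a) (tnth t i) w | i < n]] =
  PW [set w | B [tuple shifted_shape h w (tnth t i) | i < n]].
Proof.
move=> mB; apply: (eq_measure_off_null measurable_W_null prob_W_null).
- rewrite -[X in measurable X]setTI.
  apply: (_ : measurable_fun setT (fun w => [tuple lag h (Theta W a) (tnth t i) w | i < n])) => //.
  apply/measurable_fun_tnthP => i.
  rewrite (_ : _ \o _ = lag h (Theta W a) (tnth t i)); first exact: measurable_theta.
  by apply/funext => w /=; rewrite tnth_mktuple.
- rewrite -[X in measurable X]setTI.
  apply: (_ : measurable_fun setT (fun w => [tuple shifted_shape h w (tnth t i) | i < n])) => //.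
  apply/measurable_fun_tnthP => i.
  rewrite (_ : _ \o _ = fun w => shifted_shape h w (tnth t i)).
    exact: measurableT_comp (measurable_Feval _) (measurable_shifted_shape h).
  by apply/funext => w /=; rewrite tnth_mktuple.
- move=> w /eqP Wa /=.
  rewrite (_ : [tuple lag h (Theta W a) (tnth t i) w | i < n] =
               [tuple shifted_shape h w (tnth t i) | i < n])//.
  by apply: eq_from_tnth => i; rewrite !tnth_mktuple shifted_shape_theta.
Qed.

(** A translation invariant event on paths, restricting to a given cylinder for
    paths vanishing at s; its indicator is the functional that deduces c) from
    b). The condition at s secures the invariance, since recentring does nothing
    when f(s) = -oo. *)
Definition centred_at (s : T) n (t : n.-tuple T) (B : set (n.-tuple (\bar R))) : set (Fminf R T) :=
  [set f : Fminf R T | f s != -oo /\ B [tuple recenter s f (tnth t i) | i < n]].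

Lemma measurable_centred_at (s : T) n (t : n.-tuple T) (B : set (n.-tuple (\bar R))) :
  measurable B -> measurable (centred_at s t B).
Proof.
move=> mB; apply: measurableI.
  rewrite -[X in measurable X]setTI; apply: emeasurable_neq => //.
  exact: measurable_Feval.
rewrite -[X in measurable X]setTI.
apply: (_ : measurable_fun setT (fun f : Fminf R T => [tuple recenter s f (tnth t i) | i < n])) => //.
apply/measurable_fun_tnthP => i.
rewrite (_ : _ \o _ = fun f : Fminf R T => recenter s f (tnth t i)).
  exact: measurableT_comp (measurable_Feval _) (measurable_recenter s).
by apply/funext => w /=; rewrite tnth_mktuple.
Qed.

Lemma prob_centred_at h n (t : n.-tuple T) (B : set (n.-tuple (\bar R))) : measurable B ->
  PW [set w | B [tuple shifted_shape h w (tnth t i) | i < n]] =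
  PW (shifted_shape h @^-1` centred_at (a + h)%R t B).
Proof.
move=> mB; apply: (eq_measure_off_null measurable_W_null prob_W_null).
- rewrite -[X in measurable X]setTI.
  apply: (_ : measurable_fun setT (fun w => [tuple shifted_shape h w (tnth t i) | i < n])) => //.
  apply/measurable_fun_tnthP => i.
  rewrite (_ : _ \o _ = fun w => shifted_shape h w (tnth t i)).
    exact: measurableT_comp (measurable_Feval _) (measurable_shifted_shape h).
  by apply/funext => w /=; rewrite tnth_mktuple.
- rewrite -[X in measurable X]setTI; apply: measurable_shifted_shape => //.
  exact: measurable_centred_at.
- move=> w /eqP Wa.
  have sh0 : shifted_shape h w (a + h)%R = 0.
    rewrite shifted_shape_theta// /lag addrK /Theta subee//.
    by rewrite fin_numE Wa Ffun_neqy.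
  have tE : [tuple shifted_shape h w (tnth t i) | i < n] =
      [tuple recenter (a + h)%R (shifted_shape h w) (tnth t i) | i < n].
    by apply: eq_from_tnth => i; rewrite !tnth_mktuple recenterE sh0// sube0.
  split => [Bw|[_]]; last by rewrite -tE.
  by split; [rewrite sh0|rewrite -tE].
Qed.

(** Where W(a) = -oo, [Theta] takes the value +oo and the extended functional is
    0; this event is null. *)
Lemma integral_Gam_theta (Gam : Fminf R T -> R) h :
  (forall f, (0 <= Gam f)%R) -> measurable_fun setT Gam ->
  (forall f c, Gam (Fadd f c) = Gam f) ->
  \int[PW]_w (Fext Gam (lag h (fun t => Theta W a t w)))%:E =
  \int[PW]_w (Gam (shifted_shape h w))%:E.
Proof.
move=> G0 mG invG.
have FE w : Fext Gam (lag h (fun t => Theta W a t w)) =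
    if W w a == -oo then 0%R else Gam (shifted_shape h w).
  case: eqP => Wa; last by rewrite -shifted_shape_theta ?Fext_Ffun//; exact/eqP.
  have [t Wt] := Ffun_nontrivial (W w).
  rewrite /Fext; case: pselect => // -[f fE]; exfalso.
  have := Ffun_neqy f (t + h)%R; rewrite fE /lag addrK /Theta Wa.
  by have := Ffun_neqy (W w) t; case: (W w t) Wt.
under eq_integral do rewrite FE.
have mGs : measurable_fun setT (fun w => Gam (shifted_shape h w)).
  exact: measurableT_comp mG (measurable_shifted_shape h).
apply: ae_eq_integral => //.
- apply/measurable_EFinP; apply: measurable_fun_ifT => //.
  apply: (measurable_fun_bool true).
  rewrite (_ : _ @^-1` _ = W_null); first by rewrite setTI.
  by apply/seteqP; split => w /= /eqP.
- exact/measurable_EFinP.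
- exists W_null; split => //; first exact: prob_W_null.
  move=> w /= h1; apply: contrapT => /eqP Wa; apply: h1 => _.
  by rewrite (negbTE Wa).
Qed.

End theta_process.

Lemma Fext_ge0 (R : realType) (T : zmodType) (Gam : Fminf R T -> R) (f : T -> \bar R) :
  (forall g, (0 <= Gam g)%R) -> (0 <= Fext Gam f)%R.
Proof. by move=> G0; rewrite /Fext; case: pselect. Qed.

Lemma integral_Fext_spectral (R : realType) (T : zmodType)
    d (O : measurableType d) (P : probability O R) (Y : T -> O -> \bar R) s
    (Gam : Fminf R T -> R) : process Y -> (forall f c, Gam (Fadd f c) = Gam f) ->
  \int[P]_w (expeR (Y s w) * (Fext Gam (Y ^~ w))%:E) = spectral P Y s (EFin \o Gam).
Proof.
move=> pY invG; apply: eq_integral => w _.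
have [Yw|Yw] := eqVneq (Y s w) -oo; first by rewrite Yw !mul0e.
congr (_ * _%:E); rewrite /recenter invG -Fext_Ffun path_atE// => t.
by have [] := pY t.
Qed.

Section equivalence.
Context (R : realType) (T : zmodType)
  d (O : measurableType d) (P : probability O R) (Z : T -> O -> \bar R)
  d' (O' : measurableType d') (P' : probability O' R)
  (Q : nat -> O' -> R) (Zi : nat -> T -> O' -> \bar R)
  (dV : T -> measure_display) (OV : forall h, measurableType (dV h))
  (PV : forall h, probability (OV h) R) (V : forall h, OV h -> Fminf R T)
  (dW : T -> measure_display) (OW : forall h, measurableType (dW h))
  (PW : forall h, probability (OW h) R) (W : forall h, OW h -> Fminf R T).
Hypothesis Z_process : process Z.
Hypothesis EZ : forall t, \int[P]_w expeR (Z t w) = 1.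
Hypothesis QZi : max_stable_construction P Z P' Q Zi.
Hypothesis V_law : forall h, conditional_law P Z h (PV h) (@V h).
Hypothesis W_law : forall h, tilted_law h (PV h) (@V h) (PW h) (@W h).

(** The processes Theta_{a+h} and L^h Theta_a have the same law on the path
    space; a), b) and c) are all compared with this property. *)
Definition shift_invariant_shapes := forall (a h : T) (A : set (Fminf R T)), measurable A ->
  PW (a + h)%R (shifted_shape (a + h)%R (@W (a + h)%R) 0%R @^-1` A) =
  PW a (shifted_shape a (@W a) h @^-1` A).

Let lag0 (A : Type) (f : T -> A) : lag 0%R f = f.
Proof. by apply/funext => t; rewrite /lag subr0. Qed.

Let mshape s h : measurable_fun setT (shifted_shape s (@W s) h).
Proof. exact: measurable_shifted_shape (W_law s) h. Qed.

Let shape_expectation s h (g : Fminf R T -> \bar R) : measurable_fun setT g ->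
  (forall f, 0 <= g f) ->
  \int[PW s]_w g (shifted_shape s (@W s) h w) = spectral P (lag h Z) (s + h)%R g.
Proof. exact: (shifted_shape_expectation Z_process (EZ s) (V_law s) (W_law s)). Qed.

Let shape_expectation0 s (g : Fminf R T -> \bar R) : measurable_fun setT g ->
  (forall f, 0 <= g f) ->
  \int[PW s]_w g (shifted_shape s (@W s) 0%R w) = spectral P Z s g.
Proof. by move=> mg g0; rewrite shape_expectation// lag0 addr0. Qed.

Let lag_process h : process (lag h Z). Proof. exact: process_lag. Qed.

Lemma shapes_spectral : shift_invariant_shapes ->
  forall s h (g : Fminf R T -> \bar R), measurable_fun setT g -> (forall f, 0 <= g f) ->
  spectral P Z s g = spectral P (lag h Z) s g.
Proof.
move=> inv s h g mg g0.
suff sE a : spectral P Z (a + h)%R g = spectral P (lag h Z) (a + h)%R g.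
  by rewrite -(subrK h s).
rewrite -shape_expectation0// -shape_expectation//.
by apply: eq_law_integral => //; exact: inv.
Qed.

Lemma stationary_shapes : stationary P' (zeta Q Zi) -> shift_invariant_shapes.
Proof.
move=> /(stationary_zetaP Z_process EZ QZi) inv a h.
apply: (eq_law_below (measurable_FminfE R T)) => // l.
have := prob_below_top_mass Z_process (@mshape (a + h)%R 0%R) (@shape_expectation0 _).
move=> /(_ l) ->.
have := prob_below_top_mass (lag_process h) (@mshape a h) (@shape_expectation _ _).
move=> /(_ l) ->.
apply: eq_top_mass.
- by move=> t; have [] := Z_process t.
- by move=> t; have [] := Z_process t.
- exact: EZ.
- by move=> t; have [] := lag_process h t.
- by move=> t; have [] := lag_process h t.
- by move=> t; exact: EZ.
- exact: inv.
Qed.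

Lemma shapes_stationary : shift_invariant_shapes -> stationary P' (zeta Q Zi).
Proof.
move=> inv; apply/(stationary_zetaP Z_process EZ QZi) => h l.
apply: (eq_integral_hmax Z_process (lag_process h)) => s l1 l2.
apply: shapes_spectral => //.
by apply/measurable_EFinP; apply: measurable_indic; exact: measurable_shape.
Qed.

Definition functional_identity := forall Gam : Fminf R T -> R,
  (forall f, (0 <= Gam f)%R) ->
  measurable_fun setT Gam ->
  (forall (f : Fminf R T) (c : R), Gam (Fadd f c) = Gam f) ->
  forall a h : T,
    let X1 w := expeR (Z (a + h)%R w) * (Fext Gam (Z ^~ w))%:E in
    let X2 w := expeR (Z a w) * (Fext Gam (lag h (Z ^~ w)))%:E in
    let X3 w := (Fext Gam (lag h (fun t => Theta (@W a) a t w)))%:E in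
    expectation_exists P X1 -> expectation_exists P X2 ->
    expectation_exists (PW a) X3 ->
    \int[P]_w X1 w = \int[P]_w X2 w /\
    \int[P]_w X2 w = \int[PW a]_w X3 w.

Let lag_Fext_spectral (Gam : Fminf R T -> R) a h :
  (forall f c, Gam (Fadd f c) = Gam f) ->
  \int[P]_w (expeR (Z a w) * (Fext Gam (lag h (Z ^~ w)))%:E) =
  spectral P (lag h Z) (a + h)%R (EFin \o Gam).
Proof.
move=> invG; rewrite -integral_Fext_spectral//.
by apply: eq_integral => w _; rewrite /lag addrK.
Qed.

Lemma shapes_functional : shift_invariant_shapes -> functional_identity.
Proof.
move=> inv Gam G0 mG invG a h X1 X2 X3 _ _ _.
have mEG : measurable_fun setT (EFin \o Gam) by exact/measurable_EFinP.
have EG0 f : 0 <= (EFin \o Gam) f by rewrite /= lee_fin.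
rewrite lag_Fext_spectral// integral_Fext_spectral//; split.
  exact: shapes_spectral.
rewrite -shape_expectation//; apply/esym.
exact: integral_Gam_theta Z_process (EZ a) (V_law a) (W_law a) _ _ _ _ _.
Qed.

Definition theta_identity := forall a h : T,
  fdd_eq (PW (a + h)%R) (Theta (@W (a + h)%R) (a + h)%R)
         (PW a) (lag h (Theta (@W a) a)).

Lemma theta_shapes : theta_identity -> shift_invariant_shapes.
Proof.
move=> tid a h; have thE s g l : PW s [set w | below l (Ffun (shifted_shape s (@W s) g w))] =
    PW s [set w | below l (lag g (Theta (@W s) s) ^~ w)].
  apply/esym.
  have shE (n : nat) := prob_tuple_theta Z_process (EZ s) (V_law s) (W_law s) g (n := n).
  have : fdd_eq (PW s) (lag g (Theta (@W s) s)) (PW s)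
    (fun t w => shifted_shape s (@W s) g w t) by move=> n t B mB; exact: shE.
  by move=> /fdd_eq_below.
apply: (eq_law_below (measurable_FminfE R T)) => // l.
rewrite !thE lag0; exact: fdd_eq_below.
Qed.

Lemma functional_theta : functional_identity -> theta_identity.
Proof.
move=> fid a h n t B mB.
rewrite -{1}(lag0 (Theta (@W (a + h)%R) (a + h)%R)).
rewrite (prob_tuple_theta Z_process (EZ _) (V_law _) (W_law _) 0%R)//.
rewrite (prob_tuple_theta Z_process (EZ _) (V_law _) (W_law _) h)//.
have pE s g := prob_centred_at Z_process (EZ s) (V_law s) (W_law s) g t mB.
rewrite !pE addr0.
pose Gam : Fminf R T -> R := \1_(centred_at (a + h)%R t B).
have mG : measurable_fun setT Gam.
  by apply: measurable_indic; exact: measurable_centred_at.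
have G0 f : (0 <= Gam f)%R by [].
have invG f c : Gam (Fadd f c) = Gam f.
  rewrite /Gam !indicE; congr ((nat_of_bool _)%:R).
  suff DE : centred_at (a + h)%R t B (Fadd f c) = centred_at (a + h)%R t B f.
    by apply/idP/idP; rewrite !inE DE.
  have [fs|fs] := eqVneq (f (a + h)%R) -oo.
    by apply/propext; split => -[]; rewrite /= fs.
  have rE : recenter (a + h)%R (Fadd f c) = recenter (a + h)%R f.
    apply: Ffun_inj; rewrite !recenterE//.
      apply/funext => u /=; have := Ffun_neqy f (a + h)%R.
      case: (f (a + h)%R) fs => // y _ _.
      by case: (f u) => [r| |]//=; congr EFin; ring.
    by move: fs => /=; case: (f (a + h)%R).
  rewrite /centred_at /mkset rE; apply/propext; split => -[_ ?]; split => //.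
  by move: fs => /=; case: (f (a + h)%R).
have ex d0 (O0 : measurableType d0) (P0 : probability O0 R) (X : O0 -> \bar R) :
    (forall w, 0 <= X w) -> expectation_exists P0 X.
  move=> X0; right; rewrite integral0_eq ?ltry// => w _.
  by rewrite funenegE max_r// oppe_le0.
have [] := fid Gam G0 mG invG a h.
- by apply: ex => w; rewrite mule_ge0 ?expeR_ge0// lee_fin Fext_ge0.
- by apply: ex => w; rewrite mule_ge0 ?expeR_ge0// lee_fin Fext_ge0.
- by apply: ex => w; rewrite lee_fin Fext_ge0.
have mEG : measurable_fun setT (EFin \o Gam) by exact/measurable_EFinP.
rewrite lag_Fext_spectral// integral_Fext_spectral//.
rewrite -shape_expectation0// -shape_expectation// => GE _.
have intE s g : \int[PW s]_w (Gam (shifted_shape s (@W s) g w))%:E =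
    PW s (shifted_shape s (@W s) g @^-1` centred_at (a + h)%R t B).
  rewrite -[X in PW s X]setIT -integral_indic//.
  rewrite -[X in measurable X]setTI; apply: mshape => //.
  exact: measurable_centred_at.
by rewrite -!intE.
Qed.

End equivalence.

Theorem theorem4p3 (R : realType) (k : time_domain) (dim : nat)
  (dim_gt0 : (0 < dim)%N)
  (d : measure_display) (O : measurableType d) (P : probability O R)
  (Z : time_space R k dim -> O -> \bar R)
  (Z_process : process Z)
  (EZ : forall t, \int[P]_w expeR (Z t w) = 1)
  (d' : measure_display) (O' : measurableType d') (P' : probability O' R)
  (Q : nat -> O' -> R) (Zi : nat -> time_space R k dim -> O' -> \bar R)
  (QZi : max_stable_construction P Z P' Q Zi)
  (dV : time_space R k dim -> measure_display)
  (OV : forall h, measurableType (dV h)) (PV : forall h, probability (OV h) R)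
  (V : forall h, OV h -> Fminf R (time_space R k dim))
  (V_law : forall h, conditional_law P Z h (PV h) (V h))
  (dW : time_space R k dim -> measure_display)
  (OW : forall h, measurableType (dW h)) (PW : forall h, probability (OW h) R)
  (W : forall h, OW h -> Fminf R (time_space R k dim))
  (W_law : forall h, tilted_law h (PV h) (V h) (PW h) (W h)) :
  [<-> stationary P' (zeta Q Zi) ;

       forall Gam : Fminf R (time_space R k dim) -> R,
         (forall f, (0 <= Gam f)%R) ->
         measurable_fun setT Gam ->
         (forall (f : Fminf R (time_space R k dim)) (c : R),
            Gam (Fadd f c) = Gam f) ->
         forall a h : time_space R k dim,
           let X1 w := expeR (Z (a + h)%R w) * (Fext Gam (Z ^~ w))%:E in
           let X2 w := expeR (Z a w) * (Fext Gam (lag h (Z ^~ w)))%:E in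
           let X3 w :=
             (Fext Gam (lag h (fun t => Theta (@W a) a t w)))%:E in
           expectation_exists P X1 -> expectation_exists P X2 ->
           expectation_exists (PW a) X3 ->
           \int[P]_w X1 w = \int[P]_w X2 w /\
           \int[P]_w X2 w = \int[PW a]_w X3 w ;

       forall a h : time_space R k dim,
         fdd_eq (PW (a + h)%R) (Theta (@W (a + h)%R) (a + h)%R)
                (PW a) (lag h (Theta (@W a) a))].
Proof.
split; first by move=> st; apply: (shapes_functional Z_process EZ V_law W_law);
  exact: (stationary_shapes Z_process EZ QZi V_law W_law).
split; first exact: (functional_theta Z_process EZ V_law W_law).
move=> tid; apply: (shapes_stationary Z_process EZ QZi V_law W_law).
exact: (theta_shapes Z_process EZ V_law W_law).
Qed.
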